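(* Let $s$, $q$ and $k$ be positive integers satisfying $$(q-k)^2 \leq s-k^2.$$ Then $\widehat{\alpha}(s) \geq q$, where $\widehat{\alpha}(s)$ denotes the Waldschmidt constant of the ideal of $s$ very general lines in $\mathbb{P}^3$.
   Context: Let $\mathbb{K}$ be an uncountable algebraically closed field of characteristic $0$ and $R=\mathbb{K}[x_0,\dots,x_3]$. For a homogeneous ideal $I\subset R$, the $m$-th symbolic power is $I^{(m)}=R\cap\bigcap_{P\in\mathrm{Ass}(I)}I^mR_P$ (intersection taken in the fraction field of $R$). The initial degree of a nonzero homogeneous ideal $I$ is $\alpha(I)=\min\{t: (I)_t\neq 0\}$, where $(I)_t$ is the degree $t$ part of $I$. The Waldschmidt constant of $I$ is $\widehat{\alpha}(I)=\lim_{m\to\infty}\alpha(I^{(m)})/m$ (the limit exists). ''Very general'' means: outside a countable union of proper Zariski closed subsets of the parameter space (here the product of $s$ copies of the Grassmannian of lines in $\mathbb{P}^3$). For an integer $s\ge 1$, $\widehat{\alpha}(s)$ denotes the Waldschmidt constant of the radical ideal of the union of $s$ very general lines in $\mathbb{P}^3$. *)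

(* Defs.v *)
From mathcomp Require Import all_boot all_order all_algebra.
From mathcomp Require Import mpoly.
From mathcomp Require Import boolp classical_sets functions cardinality.
From mathcomp Require Import reals topology normedtype sequences.

Set Implicit Arguments.
Unset Strict Implicit.
Unset Printing Implicit Defensive.

Import Order.TTheory GRing.Theory Num.Theory numFieldNormedType.Exports.
Local Open Scope classical_set_scope.
Local Open Scope ring_scope.

(* The products of m elements of I generate I^m; for m = 0 this is the unit ideal. *)
Definition ideal_power (A : comNzRingType) (I : set A) (m : nat) : set A :=
  [set f | exists r (a : 'I_r -> A) (g : 'I_r -> 'I_m -> A),
     (forall i j, I (g i j)) /\ f = \sum_(i < r) a i * \prod_(j < m) g i j].

Definition associated_prime (A : comNzRingType) (I P : set A) : Prop :=
  [/\ idealr_closed [pred x in P], prime_idealr_closed [pred x in P]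
    & exists f : A, P = [set g | I (g * f)]].

(* J A_P, as a subset of the fraction field of A *)
Definition localized_ideal (A : idomainType) (J P : set A) : set {fraction A} :=
  [set x | exists a u, [/\ J a, ~ P u & x = tofrac a / tofrac u]].

Definition symbolic_power (A : idomainType) (I : set A) (m : nat) : set A :=
  [set f | forall P, associated_prime I P ->
     localized_ideal (ideal_power I m) P (tofrac f)].

Definition nonzero_in_degree (K : fieldType) n (I : set {mpoly K[n]}) (t : nat) :
  Prop := exists f, [/\ I f, f \is t.-homog & f != 0].

(* Junk value 0 when I contains no nonzero homogeneous element. *)
Definition initial_degree (K : fieldType) n (I : set {mpoly K[n]}) : nat :=
  xget 0%N [set t | nonzero_in_degree I t /\
                    forall t', nonzero_in_degree I t' -> (t <= t')%N].

Definition is_waldschmidt (R : realType) (K : fieldType) n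
    (I : set {mpoly K[n]}) (w : R) : Prop :=
  (fun m : nat => (initial_degree (symbolic_power I m))%:R / m%:R : R) @ \oo --> w.

(* A line of P^3, that is a point of the Grassmannian, is a plane of K^4. *)
Definition line (K : fieldType) := {L : {vspace 'rV[K]_4} | \dim L == 2%N}.

(* All polynomials vanishing on the cones over the lines. Over an infinite field this is
   the homogeneous radical ideal generated by the forms vanishing on the lines. *)
Definition lines_ideal (K : fieldType) (s : nat) (L : 'I_s -> line K) :
    set {mpoly K[4]} :=
  [set f | forall (i : 'I_s) (p : 'rV[K]_4), p \in sval (L i) ->
     f.@[fun j => p 0 j] = 0].

(* Plucker coordinates p_ab = u_a v_b - u_b v_a of <u, v>, for the basis (u, v) chosen
   by vbasis: the point u /\ v of P(Lambda^2 K^4), Lambda^2 K^4 being identified with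
   the alternating matrices. *)
Definition plucker (K : fieldType) (L : line K) : 'M[K]_4 :=
  let u := (vbasis (sval L))`_0 in let v := (vbasis (sval L))`_1 in
  u^T *m v - v^T *m u.

Definition plucker_coords (K : fieldType) s (L : 'I_s -> line K) :
    'I_(s * (4 * 4)) -> K :=
  fun j => mxvec (\matrix_(i < s) mxvec (plucker (L i))) 0 j.

(* Homogeneous in each of the s groups of 16 variables, so that its vanishing on the
   Plucker coordinates does not depend on the bases chosen for the lines. *)
Definition is_multihomogeneous (K : fieldType) s (f : {mpoly K[s * (4 * 4)]}) :
  Prop :=
  forall i : 'I_s, exists d : nat, forall mon, mon \in msupp f ->
    (\sum_(j < 4 * 4) mon (mxvec_index i j) = d)%N.

Definition zariski_closed (K : fieldType) s (Z : set ('I_s -> line K)) : Prop :=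
  exists F : set {mpoly K[s * (4 * 4)]},
    (forall f, F f -> is_multihomogeneous f) /\
    Z = [set L | forall f, F f -> f.@[plucker_coords L] = 0].

Definition very_general (K : fieldType) s (P : ('I_s -> line K) -> Prop) : Prop :=
  exists Z : nat -> set ('I_s -> line K),
    (forall n, zariski_closed (Z n) /\ Z n != setT) /\
    forall L, ~ (\bigcup_n Z n) L -> P L.

(* The real w such that s very general lines have Waldschmidt constant w. The junk
   value, should no such w exist, is 0. *)
Definition waldschmidt_lines (R : realType) (K : fieldType) (s : nat) : R :=
  xget 0 [set w | @very_general K s (fun L => is_waldschmidt (lines_ideal L) w)].

(* Main.v *)
Require Import Defs.
From HB Require Import structures.
From mathcomp Require Import all_boot all_order all_algebra.
From mathcomp Require Import mpoly zify ring lra.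
From mathcomp Require Import boolp classical_sets functions cardinality.
From mathcomp Require Import reals topology normedtype sequences.

(* Specialize the lines. Write q = k + a with k^2 + a^2 <= s and take, in the chart with
   coordinates x, y, z, the k^2 lines z = c_i, x = b_l and the a^2 lines y = e_j, x = b'_l.
   Let f of degree d vanish to order m along them. Dividing f successively by the z - c_i
   (a Newton expansion) and keeping the first nonzero remainder yields a nonzero g in K[x,y]
   of degree at most d - alpha divisible by prod (x - b_l)^mu, where k mu + alpha >= k m,
   and the multiplicities along the second family survive. The same with the y - e_j leads
   to a nonzero h in K[x] of degree at most d - alpha - beta divisible by
   prod (x - b_l)^mu prod (x - b'_l)^nu, where a nu + beta >= a m; hence d >= (k + a) m.

   A form lies in the m-th symbolic power iff it vanishes to order m along every line, and
   the existence of a nonzero form of degree t doing so is a closed condition: it is the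
   vanishing of the maximal minors of a matrix with entries polynomial in the Pluecker
   coordinates. Off the countably many such loci that are proper, the initial degrees of the
   symbolic powers do not depend on the lines and are at least q m; the limit exists by
   subadditivity, and the complement of the loci is not empty since K is uncountable. *)

Set Implicit Arguments.
Unset Strict Implicit.
Unset Printing Implicit Defensive.

Import Order.TTheory GRing.Theory Num.Theory numFieldNormedType.Exports.
Local Open Scope classical_set_scope.
Local Open Scope ring_scope.

(** * Successive division by z - c_i *)

Section Peeling.
Variables (K : fieldType) (S : idomainType) (iota : {rmorphism K -> S}).

Definition translate (c : K) (f : {poly S}) : {poly S} := f \Po ('X + (iota c)%:P).

Lemma translateM c f g : translate c (f * g) = translate c f * translate c g.
Proof. exact: comp_polyM. Qed.

Lemma translateD c f g : translate c (f + g) = translate c f + translate c g.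
Proof. exact: comp_polyD. Qed.

Lemma coef0_translate c f : (translate c f)`_0 = f.[iota c].
Proof. by rewrite -horner_coef0 horner_comp !hornerE. Qed.

Lemma translate_XsubC c c' :
  translate c' ('X - (iota c)%:P) = 'X + (iota (c' - c))%:P.
Proof. by rewrite /translate comp_polyB comp_polyX comp_polyC rmorphB polyCB addrA. Qed.

(** [F D] stands for degree less than [D] together with side conditions; kept abstract, it serves
    both rounds of division. *)
Variables (F : nat -> S -> Prop) (a : S).
Hypothesis FD : forall D x y, F D x -> F D y -> F D (x + y).
Hypothesis FZ : forall D c x, F D x -> F D (iota c * x).
Hypothesis Fmono : forall D D' x, (D <= D')%N -> F D x -> F D' x.

Lemma filtered0 D x : F D x -> F D 0.
Proof. by move/(FZ 0); rewrite rmorph0 mul0r. Qed.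

Lemma horner_filtered D (f : {poly S}) c :
  (forall p, F (D - p) f`_p) -> F D f.[iota c].
Proof.
move=> Ff; rewrite horner_coef; elim/big_rec: _ => [|i x _ Fx].
  by apply: filtered0 (Fmono _ (Ff 0%N)); rewrite leq_subr.
apply: FD => //; rewrite -rmorphXn mulrC; apply: FZ.
exact: Fmono (leq_subr _ _) (Ff i).
Qed.

(** The coefficients of [f] are recovered from the top down: index p + 1 of the product gives index
    p of [f] up to a multiple of index p + 1. *)
Lemma divide_filtered D (f : {poly S}) c :
  (forall p, F (D - p) (('X - (iota c)%:P) * f)`_p) ->
  forall p, F (D.-1 - p) f`_p.
Proof.
move=> Ff p; have [n] := ubnP (size f - p)%N.
elim: n p => // n IHn p ltn.
have := Ff p.+1; rewrite mulrBl coefB coefXM /= coefCM => Fp.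
have [lep|ltp] := leqP (size f) p.
  by rewrite nth_default //; apply: filtered0 (Fmono _ (Ff p.+1)); lia.
have -> : f`_p = f`_p - iota c * f`_p.+1 + iota c * f`_p.+1 by rewrite subrK.
apply: FD; first by apply: Fmono Fp; lia.
by apply: FZ; apply: Fmono (IHn p.+1 _); lia.
Qed.

(** Membership in the ideal power $(a, X)^{mu}$, coefficient by coefficient. *)
Definition adic (mu : nat) (f : {poly S}) : Prop :=
  forall p, exists h, f`_p = a ^+ (mu - p) * h.

(** Since [c] is nonzero, the coefficients of [f] can be solved for from the bottom up; the
    preceding one carries at least as high a power of [a]. *)
Lemma divide_adic_other mu (f : {poly S}) c :
  c != 0 -> adic mu (('X + (iota c)%:P) * f) -> adic mu f.
Proof.
move=> c0 adf p; elim: p => [|p [h hE]].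
  have [h] := adf 0%N; rewrite mulrDl coefD coefXM /= coefCM add0r => hE.
  exists (iota c^-1 * h); rewrite mulrCA -hE mulrA -rmorphM mulVf //.
  by rewrite rmorph1 mul1r.
have [h'] := adf p.+1; rewrite mulrDl coefD coefXM /= coefCM hE => hE'.
have -> : f`_p.+1 = iota c^-1 * (iota c * f`_p.+1).
  by rewrite mulrA -rmorphM mulVf // rmorph1 mul1r.
have -> : iota c * f`_p.+1 =
   a ^+ (mu - p.+1) * h' - a ^+ (mu - p) * h by rewrite -hE' addrC addKr.
have -> : (mu - p = (mu - p.+1) + (mu - p - (mu - p.+1)))%N by lia.
rewrite exprD -mulrA -mulrBr mulrCA; by eexists.
Qed.

Lemma divide_adic_same mu (f : {poly S}) : adic mu ('X * f) -> adic mu.-1 f.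
Proof.
move=> adf p; have [h] := adf p.+1; rewrite coefXM /= => ->.
by exists h; congr (a ^+ _ * _); lia.
Qed.

(* Either g comes from f(c_i), or X - c_i divides f and the quotient has one multiplicity
   less; taking mu i maximal gives the bound on the sum of the mu i in the first case. *)
Lemma peeling n (c : 'I_n -> K) (mu : 'I_n -> nat) D (f : {poly S}) :
  injective c -> f != 0 -> (forall p, F (D - p) f`_p) ->
  (forall i, adic (mu i) (translate (c i) f)) ->
  exists alpha mu0 g, [/\ g != 0, F (D - alpha) (a ^+ mu0 * g)
                        & (\sum_i mu i <= n * mu0 + alpha)%N].
Proof.
move=> cinj; have [N] := ubnP (size f); elim: N mu D f => // N IHN mu D f ltN f0 Ff adf.
have [/existsP[i0 _]|/existsPn mu0] := boolP [exists i, mu i != 0%N]; last first.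
  (* With all multiplicities 0, the leading coefficient serves as [g] and [alpha] is the degree of
     [f]. *)
  exists (size f).-1, 0%N, (lead_coef f); split; first by rewrite lead_coef_eq0.
    by rewrite expr0 mul1r; apply: Ff.
  by rewrite big1 // => i _; apply/eqP; have := mu0 i; rewrite negbK.
case: (@arg_maxnP _ i0 xpredT mu isT) => i _ max_i.
have [fi0|fi0] := eqVneq f.[iota (c i)] 0; last first.
  have [h hE] := adf i 0%N; rewrite subn0 coef0_translate in hE.
  exists 0%N, (mu i), h; split.
  - by apply: contraNneq fi0 => h0; rewrite hE h0 mulr0.
  - by rewrite -hE subn0; apply: horner_filtered.
  rewrite addn0 -[X in (X * _)%N](card_ord n) -sum_nat_const.
  by apply: leq_sum => j _; apply: max_i.
have /factor_theorem[f' fE] : root f (iota (c i)) by apply/eqP.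
rewrite mulrC in fE; subst f.
have f'0 : f' != 0 by move: f0; rewrite mulf_eq0 negb_or => /andP[].
have ltf' : (size f' < N)%N.
  by move: ltN; rewrite size_mul ?polyXsubC_eq0 // size_XsubC.
(* At another [c j] the removed factor becomes X plus the nonzero constant [c j - c i], so only the
   multiplicity at [c i] drops. *)
pose mu' j := if j == i then (mu j).-1 else mu j.
have Ff' := divide_filtered Ff.
have adf' j : adic (mu' j) (translate (c j) f').
  have := adf j; rewrite translateM translate_XsubC /mu'.
  have [->|ji] := eqVneq j i.
    by rewrite subrr rmorph0 polyC0 addr0; apply: divide_adic_same.
  by apply: divide_adic_other; rewrite subr_eq0 (inj_eq cinj).
have [alpha [mu0 [g [g0 Fg leg]]]] := IHN mu' D.-1 f' ltf' f'0 Ff' adf'.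
exists alpha.+1, mu0, g; split => //; first by apply: Fmono Fg; lia.
have : (\sum_j mu j <= \sum_j (mu' j + (j == i)))%N.
  by apply: leq_sum => j _; rewrite /mu'; case: eqP => _; lia.
have -> : \sum_j (mu' j + (j == i)) = (\sum_j mu' j + 1)%N.
  rewrite big_split /=; congr addn.
  by rewrite (bigD1 i) //= eqxx big1 // => j /negPf ->.
lia.
Qed.

End Peeling.

(** * The degree bound for the two families of lines *)

Lemma coprimep_XsubC_prod (K : fieldType) (I : eqType) (s : seq I) (b : I -> K) x :
  (forall i, i \in s -> b i != x) ->
  coprimep ('X - x%:P) (\prod_(i <- s) ('X - (b i)%:P)).
Proof.
move=> bx; rewrite coprimep_sym coprimep_XsubC /root horner_prod.
rewrite prodf_seq_neq0; apply/allP => i si /=.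
by rewrite !hornerE subr_eq0 eq_sym bx.
Qed.

Lemma dvdp_prod_XsubC_exp (K : fieldType) (I : finType) (b : I -> K) r (g : {poly K}) :
  injective b -> (forall i, ('X - (b i)%:P) ^+ r %| g) ->
  (\prod_i ('X - (b i)%:P)) ^+ r %| g.
Proof.
move=> binj dvdg; rewrite -big_enum /=; elim: (enum I) (enum_uniq I) => [|i s IHs] /=.
  by rewrite big_nil expr1n dvd1p.
move=> /andP[is_ us]; rewrite big_cons exprMn Gauss_dvdp ?dvdg ?IHs //.
apply/coprimep_expl/coprimep_expr/coprimep_XsubC_prod => j js.
by rewrite (inj_eq binj); apply: contraNneq is_ => <-.
Qed.

Lemma dvdp_coefs (K : fieldType) (c : {poly K}) (g : {poly {poly K}}) :
  (forall r, c %| g`_r) -> exists h, g = c%:P * h.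
Proof.
move=> cg; exists (\poly_(r < size g) (g`_r %/ c)).
apply/polyP => r; rewrite coefCM coef_poly.
case: ltnP => [_|le]; first by rewrite mulrC divpK.
by rewrite mulr0 nth_default.
Qed.

Lemma size_prod_ord_XsubC (K : fieldType) n (b : 'I_n -> K) :
  size (\prod_i ('X - (b i)%:P)) = n.+1.
Proof.
by rewrite size_prod_XsubC [index_enum _]unlock -enumT size_enum_ord.
Qed.

Definition constP2 (K : fieldType) : {rmorphism K -> {poly {poly K}}} := polyC \o polyC.

(** The variables are x (innermost), y and z (outermost); the divisibility hypotheses place [f] in
    $(x-b_l, z-c_i)^m$ and $(x-b'_l, y-e_j)^m$. Division in z, then in y, costs [alpha] and [beta]
    in degree and leaves a polynomial in x divisible by the coprime [A ^+ mu] and [B ^+ nu]. *)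
Lemma bidegree_bound (K : fieldType) k a m d (b c : 'I_k -> K) (b' e : 'I_a -> K)
    (f : {poly {poly {poly K}}}) :
  injective b -> injective b' -> injective c -> injective e ->
  (forall l l', b l != b' l') -> f != 0 ->
  (forall p p', (size (f`_p`_p')%R <= d.+1 - p - p')%N) ->
  (forall i l p r, ('X - (b l)%:P) ^+ (m - p) %|
     ((translate (constP2 K) (c i) f)`_p)`_r) ->
  (forall j l p p', ('X - (b' l)%:P) ^+ (m - p') %|
     (translate polyC (e j) f`_p)`_p') ->
  ((k + a) * m <= d)%N.
Proof.
move=> binj b'inj cinj einj bb' f0 degf vanA vanB.
pose A := \prod_l ('X - (b l)%:P); pose B := \prod_l ('X - (b' l)%:P).
(* Besides the total degree in x and y, [F D] carries the multiplicities along the second family,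
   which must survive the division in z. *)
pose F D (g : {poly {poly K}}) := (forall p', (size (g`_p')%R <= D - p')%N) /\
  forall j p', B ^+ (m - p') %| (translate polyC (e j) g)`_p'.
have [|||||alpha [mu [g [g0 [degg vang]]]]] :=
  @peeling K {poly {poly K}} (constP2 K) F A%:P _ _ _ k c (fun=> m) d.+1 f cinj f0.
- move=> D x y [dx vx] [dy vy]; split=> [p'|j p'].
    by rewrite coefD (leq_trans (size_polyD _ _)) // geq_max dx dy.
  by rewrite translateD coefD dvdp_add.
- move=> D z x [dx vx]; split=> [p'|j p'].
    by rewrite /= coefCM mul_polyC (leq_trans (size_scale_leq _ _) (dx p')).
  rewrite /= translateM {1}/translate comp_polyC coefCM.
  exact: dvdp_mull (vx j p').
- move=> D D' x leD [dx vx]; split=> // p'.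
  by rewrite (leq_trans (dx p')) // leq_sub2r.
- move=> p; split => [p'|j p']; first exact: degf.
  by apply: dvdp_prod_XsubC_exp => // l; apply: vanB.
- move=> i p; rewrite -polyC_exp; apply: dvdp_coefs => r.
  by apply: dvdp_prod_XsubC_exp => // l; apply: vanA.
rewrite sum_nat_const card_ord => bnd1.
set f2 := _ * g in degg vang.
have A0 : A != 0 by apply/prodf_neq0 => l _; rewrite polyXsubC_eq0.
have B0 : B != 0 by apply/prodf_neq0 => l _; rewrite polyXsubC_eq0.
have f20 : f2 != 0 by rewrite mulf_neq0 // expf_neq0 // polyC_eq0.
pose F2 D (h : {poly K}) := (size h <= D)%N /\ A ^+ mu %| h.
have [|||||beta [nu [h [h0 [degh dvdh]]]]] :=
  @peeling K {poly K} polyC F2 B _ _ _ a e (fun=> m) (d.+1 - alpha) f2 einj f20.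
- move=> D x y [dx vx] [dy vy]; split; last exact: dvdp_add.
  by rewrite (leq_trans (size_polyD _ _)) // geq_max dx dy.
- move=> D z x [dx vx]; split; last exact: dvdp_mull.
  by rewrite mul_polyC (leq_trans (size_scale_leq _ _)).
- by move=> D D' x leD [dx vx]; split=> //; apply: leq_trans leD.
- move=> p; split; first exact: degg.
  by rewrite /f2 -polyC_exp coefCM dvdp_mulr.
- by move=> j p; have /dvdpP[h ->] := vang j p; exists h; rewrite mulrC.
rewrite sum_nat_const card_ord => bnd2.
have AB : coprimep (A ^+ mu) (B ^+ nu).
  apply: coprimep_expl; apply: coprimep_expr; rewrite coprimep_sym /A.
  elim/big_rec: _ => [|l x _ cx]; first exact: coprimep1.
  rewrite coprimepMr cx andbT coprimep_sym; apply: coprimep_XsubC_prod => l' _.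
  by rewrite eq_sym.
have : A ^+ mu * B ^+ nu %| B ^+ nu * h by rewrite Gauss_dvdp // dvdh dvdp_mulr.
move/dvdp_leq => /(_ (mulf_neq0 (expf_neq0 _ B0) h0)) sz.
(* The product has positive size, so the truncated subtraction in $d + 1 - alpha - beta$ is a true
   one, and $k mu + a nu + alpha + beta \le d$ follows. *)
have := leq_trans sz degh.
rewrite size_mul ?expf_neq0 //.
have szX n (q : {poly K}) N : size q = N.+1 -> size (q ^+ n) = (N * n).+1.
  by move=> sq; rewrite -(prednK (_ : (0 < size (q ^+ n))%N)) ?size_poly_gt0 ?expf_neq0
     -?size_poly_gt0 ?sq // size_exp sq.
rewrite (szX mu A k) ?(szX nu B a) ?size_prod_ord_XsubC //; nia.
Qed.

(** * The affine chart *)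

Lemma natr_inj_char0 (K : fieldType) (charK : [pchar K] =i pred0) :
  injective (fun n : nat => n%:R : K).
Proof.
have le i j : (i <= j)%N -> i%:R = j%:R :> K -> i = j.
  move=> leij /eqP; rewrite eq_sym -subr_eq0 -natrB // ((pcharf0P K).1 charK) => ?; lia.
by move=> i j; have [/le|/ltnW/le h /esym/h] := leqP i j.
Qed.

Lemma poly_eq0_char0 (K : fieldType) (charK : [pchar K] =i pred0) (p : {poly K}) :
  (forall x, p.[x] = 0) -> p = 0.
Proof.
move=> p0; apply/eqP/negPn/negP => nz.
suff: (size p < size p)%N by rewrite ltnn.
have := max_poly_roots nz (rs := map (fun n => n%:R) (iota 0 (size p))).
rewrite size_map size_iota; apply.
  by apply/allP => x _; rewrite /root p0.
by rewrite map_inj_uniq ?iota_uniq //; apply: natr_inj_char0.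
Qed.

Section Chart.
Variable K : fieldType.

Definition affine_point (x y z : K) : 'I_4 -> K := fun i => [:: x; y; z; 1]`_i.

(* Dehomogenization at the last variable, as a polynomial in z over K[x][y]. *)
Definition chart : {mpoly K[4]} -> {poly {poly {poly K}}} :=
  mmap (polyC \o polyC \o polyC) (fun i : 'I_4 => [:: 'X%:P%:P; 'X%:P; 'X; 1]`_i).

HB.instance Definition _ := GRing.RMorphism.on chart.

Lemma coef_monomial3 (c : K) i j l p p' r :
  ((c *: 'X^i)%:P%:P * ('X^j)%:P * 'X^l : {poly {poly {poly K}}})`_p`_p'`_r =
  c * [&& l == p, j == p' & i == r]%:R.
Proof.
rewrite -polyCM coefCM coefXn (eq_sym p).
case: (l == p); rewrite ?mulr0 ?coef0 ?mulr0 // mulr1 coefCM coefXn (eq_sym p').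
by case: (j == p'); rewrite ?mulr0 ?coef0 ?mulr0 // mulr1 coefZ coefXn (eq_sym r).
Qed.

Lemma big_ord4 (R : Type) (idx : R) (op : Monoid.law idx) (F : 'I_4 -> R) :
  \big[op/idx]_i F i = op (op (op (F 0) (F 1)) (F 2%:R)) (F ord_max).
Proof.
rewrite !big_ord_recl big_ord0 Monoid.mulm1 !Monoid.mulmA.
by congr (op (op (op (F _) (F _)) (F _)) (F _)); apply: val_inj.
Qed.

Lemma chartE (f : {mpoly K[4]}) :
  chart f = \sum_(m <- msupp f)
    (f@_m *: 'X^(m 0))%:P%:P * ('X^(m 1))%:P * 'X^(m 2%:R).
Proof.
apply: eq_bigr => m _; rewrite /mmap1 big_ord4 -mul_polyC.
set x : {poly {poly {poly K}}} := 'X%:P%:P; set y : {poly {poly {poly K}}} := 'X%:P.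
change (polyC (polyC (polyC f@_m)) * (x ^+ m 0 * y ^+ m 1 * 'X ^+ m 2%:R * 1 ^+ m ord_max) =
  ((f@_m)%:P * 'X^(m 0))%:P%:P * ('X^(m 1))%:P * 'X^(m 2%:R)).
by rewrite [1 ^+ _]expr1n mulr1 !polyCM 2!polyC_exp [('X^_)%:P]polyC_exp !mulrA.
Qed.

Lemma coef_chart (f : {mpoly K[4]}) p p' r :
  (chart f)`_p`_p'`_r =
  \sum_(m <- msupp f) f@_m * [&& m 2%:R == p, m 1 == p' & m 0 == r]%:R.
Proof.
rewrite chartE !coef_sum; apply: eq_bigr => m _.
exact: coef_monomial3.
Qed.

Lemma mdeg4 (m : 'X_{1..4}) : mdeg m = (m 0%R + m 1%R + m 2%:R%R + m ord_max)%N.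
Proof. by rewrite mdegE big_ord4. Qed.

Lemma size_chart d (f : {mpoly K[4]}) p p' : f \is d.-homog ->
  (size ((chart f)`_p`_p')%R <= d.+1 - p - p')%N.
Proof.
move=> /dhomogP homf; apply/leq_sizeP => r ler; rewrite coef_chart big1_seq // => m /andP[_ mf].
have := homf m mf; rewrite /= mdeg4.
by case: and3P => [[/eqP ? /eqP ? /eqP ?] | _ _]; [lia | rewrite mulr0].
Qed.

(** Among monomials of degree [d] the exponents of x, y, z determine the last one, so dehomogenizing
    merges no terms and the leading one survives. *)
Lemma chart_neq0 d (f : {mpoly K[4]}) : f \is d.-homog -> f != 0 -> chart f != 0.
Proof.
move=> /dhomogP homf f0; pose m := mlead f.
have mf : m \in msupp f by apply: mlead_supp.
apply: contra_neq f0 => c0; apply/eqP; rewrite -mleadc_eq0 -/m.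
have := coef_chart f (m 2%:R) (m 1) (m 0); rewrite c0 !coef0.
rewrite (bigD1_seq m) //= ?msupp_uniq // !eqxx mulr1 big1_seq ?addr0; first by move->.
move=> m' /andP[m'm m'f]; case: and3P => [[/eqP e2 /eqP e1 /eqP e0]|]; last by rewrite mulr0.
case/eqP: m'm; apply/mnmP => i.
have := homf m' m'f; rewrite -(homf m mf) /= !mdeg4 => e3.
have [->|->|->|->] : [\/ i = 0, i = 1, i = 2%:R | i = ord_max].
  by case: i => [[|[|[|[|]]]] lti] //; [constructor 1|constructor 2|constructor 3|constructor 4];
     apply: val_inj.
all: lia.
Qed.

End Chart.

(** Elements of $I^m$ are combinations of m-fold products, so it suffices that [Q] is a
    multiplicative filtration with [phi] sending [I] into its first step. The notions of order of
    vanishing below are all of this kind. *)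
Lemma ideal_power_filtration (A S : comNzRingType) (phi : {rmorphism A -> S})
    (Q : nat -> S -> Prop) (I : set A) m f :
  (forall n, Q n 0) -> (forall x, Q 0%N x) ->
  (forall n x y, Q n x -> Q n y -> Q n (x + y)) ->
  (forall n n' x y, Q n x -> Q n' y -> Q (n + n')%N (x * y)) ->
  (forall g, I g -> Q 1%N (phi g)) -> ideal_power I m f -> Q m (phi f).
Proof.
move=> Qz Q0 QD QM QI [r [a [g [Ig ->]]]].
have Qprod n (h : 'I_n -> A) : (forall j, I (h j)) -> Q n (phi (\prod_j h j)).
  elim: n h => [|n IHn] h Ih; first by rewrite big_ord0.
  by rewrite big_ord_recl rmorphM; apply: (QM 1%N); [apply: QI | apply: IHn].
rewrite rmorph_sum; elim/big_rec: _ => // i x _ Qx; apply: QD => //.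
by rewrite rmorphM; apply: (QM 0%N) => //; apply: Qprod.
Qed.

Lemma dvdp_sum (K : fieldType) (I : Type) (s : seq I) (F : I -> {poly K}) d :
  (forall i, d %| F i) -> d %| \sum_(i <- s) F i.
Proof.
by move=> dF; elim/big_rec: _ => [|i x _ dx]; rewrite ?dvdp0 // dvdp_add.
Qed.

Lemma dvdp_expM (K : fieldType) (d x y : {poly K}) m n N :
  (N <= m + n)%N -> d ^+ m %| x -> d ^+ n %| y -> d ^+ N %| x * y.
Proof.
move=> leN dx dy; apply: dvdp_trans (dvdp_mul dx dy).
by rewrite -exprD dvdp_exp2l.
Qed.

Section VanishingInChart.
Variables (K : fieldType) (charK : [pchar K] =i pred0).

Lemma chart_horner (f : {mpoly K[4]}) x y z :
  (chart f).[z%:P%:P].[y%:P].[x] = f.@[affine_point x y z].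
Proof.
rewrite chartE mevalE !horner_sum; apply: eq_bigr => m _.
by rewrite big_ord4 !hornerE /= [affine_point x y z ord_max]/(1) expr1n mulr1.
Qed.

(** [Q m] is the m-th power of the ideal of the line in the chart; it is multiplicative because
    products convolve Taylor coefficients. *)
Lemma chart_order_xz m (I : set {mpoly K[4]}) f x z :
  ideal_power I m f -> (forall g, I g -> forall y, g.@[affine_point x y z] = 0) ->
  forall p r, ('X - x%:P) ^+ (m - p) %| ((translate (constP2 K) z (chart f))`_p)`_r.
Proof.
move=> If I0; pose Q m (F : {poly {poly {poly K}}}) := forall p r,
  ('X - x%:P) ^+ (m - p) %| ((translate (constP2 K) z F)`_p)`_r.
change (Q m (chart f)).
refine (@ideal_power_filtration {mpoly K[4]} {poly {poly {poly K}}} (@chart K) Q I m f _ _ _ _ _ If).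
- by move=> n p r; rewrite /translate comp_poly0 !coef0 dvdp0.
- by move=> F p r; rewrite sub0n expr0 dvd1p.
- by move=> n F G QF QG p r; rewrite translateD !coefD dvdp_add.
- move=> n n' F G QF QG p r; rewrite translateM coefM coef_sum; apply: dvdp_sum => i.
  rewrite coefM; apply: dvdp_sum => j; apply: dvdp_expM (QF _ _) (QG _ _).
  by have := ltn_ord i; lia.
- move=> g Ig p r; case: p => [|p]; last by rewrite subSS sub0n expr0 dvd1p.
  rewrite subn0 expr1 coef0_translate dvdp_XsubCl /root.
  set G := (chart g).[_]; suff: map_poly (horner_eval x) G = 0.
    by move/polyP/(_ r); rewrite coef_map coef0 => ?; apply/eqP.
  apply: (poly_eq0_char0 charK) => y.
  have -> : y = horner_eval x y%:P by rewrite /horner_eval hornerC.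
  rewrite horner_map -[LHS]/((chart g).[z%:P%:P].[y%:P].[x]).
  by rewrite chart_horner I0.
Qed.

Lemma chart_order_xy m (I : set {mpoly K[4]}) f x y :
  ideal_power I m f -> (forall g, I g -> forall z, g.@[affine_point x y z] = 0) ->
  forall p p', ('X - x%:P) ^+ (m - p') %| (translate polyC y (chart f)`_p)`_p'.
Proof.
move=> If I0; pose Q m (F : {poly {poly {poly K}}}) := forall p p',
  ('X - x%:P) ^+ (m - p') %| (translate polyC y F`_p)`_p'.
change (Q m (chart f)).
refine (@ideal_power_filtration {mpoly K[4]} {poly {poly {poly K}}} (@chart K) Q I m f _ _ _ _ _ If).
- by move=> n p p'; rewrite /translate coef0 comp_poly0 !coef0 dvdp0.
- by move=> F p p'; rewrite sub0n expr0 dvd1p.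
- by move=> n F G QF QG p p'; rewrite coefD translateD !coefD dvdp_add.
- move=> n n' F G QF QG p p'; rewrite coefM /translate linear_sum coef_sum; apply: dvdp_sum => i.
  rewrite /= comp_polyM coefM; apply: dvdp_sum => j.
  by apply: dvdp_expM (QF _ _) (QG _ _); have := ltn_ord j; lia.
- move=> g Ig p p'; case: p' => [|p']; last by rewrite subSS sub0n expr0 dvd1p.
  rewrite subn0 expr1 coef0_translate dvdp_XsubCl /root.
  pose ev := horner_eval x \o horner_eval y%:P.
  suff: map_poly ev (chart g) = 0.
    by move/polyP/(_ p); rewrite coef_map coef0 => ?; apply/eqP.
  apply: (poly_eq0_char0 charK) => z.
  have -> : z = ev z%:P%:P by rewrite /ev /= /horner_eval !hornerC.
  rewrite horner_map -[LHS]/((chart g).[z%:P%:P].[y%:P].[x]).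
  by rewrite chart_horner I0.
Qed.

Lemma special_position_bound k a m d (b c : 'I_k -> K) (b' e : 'I_a -> K) (f : {mpoly K[4]}) :
  injective b -> injective b' -> injective c -> injective e ->
  (forall l l', b l != b' l') -> f \is d.-homog -> f != 0 ->
  (forall i l, exists2 I, ideal_power I m f &
     forall g, I g -> forall y, g.@[affine_point (b l) y (c i)] = 0) ->
  (forall j l, exists2 I, ideal_power I m f &
     forall g, I g -> forall z, g.@[affine_point (b' l) (e j) z] = 0) ->
  ((k + a) * m <= d)%N.
Proof.
move=> binj b'inj cinj einj bb' homf f0 Hc He.
apply: bidegree_bound binj b'inj cinj einj bb' (chart_neq0 homf f0) _ _ _.
- by move=> p p'; apply: size_chart.
- by move=> i l; have [I If I0] := Hc i l; apply: chart_order_xz If I0.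
- by move=> j l; have [I If I0] := He j l; apply: chart_order_xy If I0.
Qed.

End VanishingInChart.

(** * Powers of the ideal of a line *)

(** Terms are grouped by the exponent of the first variable. With the other variables fixed, [f] is
    a univariate polynomial vanishing on all of [K], so each group vanishes at every point and the
    induction hypothesis applies to it. *)
Lemma mpoly_eq0_char0 (K : fieldType) (charK : [pchar K] =i pred0) n (f : {mpoly K[n]}) :
  (forall v, f.@[v] = 0) -> f = 0.
Proof.
elim: n f => [|n IHn] f f0.
  by rewrite (nvar0_mpolyC f); have := f0 (fun=> 0); rewrite {1}(nvar0_mpolyC f) mevalC => ->;
     rewrite mpolyC0.
pose tail (m : 'X_{1..n.+1}) := [multinom m (lift ord0 i) | i < n].
pose G k := \sum_(m <- msupp f) (f@_m * (m ord0 == k)%:R) *: 'X_[tail m].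
have G0 k : G k = 0.
  apply: IHn => v.
  pose p := \sum_(m <- msupp f) (f@_m * \prod_i v i ^+ m (lift ord0 i)) *: 'X^(m ord0).
  have p0 : p = 0.
    apply: (poly_eq0_char0 charK) => t; rewrite /p horner_sum.
    transitivity f.@[fun i => if unlift ord0 i is Some j then v j else t]; last exact: f0.
    rewrite mevalE.
    apply: eq_bigr => m _; rewrite hornerZ hornerXn big_ord_recl unlift_none -mulrA; congr (_ * _).
    by rewrite mulrC; congr (_ * _); apply: eq_bigr => i _; rewrite liftK.
  transitivity p`_k; last by rewrite p0 coef0.
  rewrite /p coef_sum /G rmorph_sum /=; apply: eq_bigr => m _.
  rewrite mevalZ mevalX coefZ coefXn eq_sym -!mulrA; congr (_ * _); rewrite mulrC.
  by congr (_ * _); apply: eq_bigr => i _; rewrite mnmE.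
apply/mpolyP => m; rewrite mcoeff0; have [mf|] := boolP (m \in msupp f); last exact: memN_msupp_eq0.
have := congr1 (mcoeff (tail m)) (G0 (m ord0)); rewrite mcoeff0 /G raddf_sum /= => <-.
rewrite (bigD1_seq m) ?msupp_uniq //= mcoeffZ mcoeffX !eqxx !mulr1 big1_seq ?addr0 //.
move=> m' /andP[nm _]; rewrite mcoeffZ mcoeffX.
have [e0|] := eqVneq (m' ord0) (m ord0); last by rewrite mulr0 mul0r.
have [et|] := eqVneq (tail m') (tail m); last by rewrite mulr0.
case/eqP: nm; apply/mnmP => i; case: (unliftP ord0 i) => [j ->|->] //.
by have /mnmP/(_ j) := et; rewrite !mnmE.
Qed.

Section IdealPower.
Variables (A : comNzRingType) (I : set A).

Lemma ideal_power0 f : ideal_power I 0 f.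
Proof.
exists 1%N, (fun=> f), (fun _ _ => 0); split; first by move=> i [].
by rewrite big_ord1 big_ord0 mulr1.
Qed.

Lemma ideal_power_zero m : ideal_power I m 0.
Proof. by exists 0%N, (fun=> 0), (fun _ _ => 0); split=> [[]//|]; rewrite big_ord0. Qed.

Lemma ideal_powerD m f g : ideal_power I m f -> ideal_power I m g -> ideal_power I m (f + g).
Proof.
move=> [r [a [x [Ix ->]]]] [r' [a' [x' [Ix' ->]]]].
exists (r + r')%N, (fun i => match fintype.split i with inl j => a j | inr j => a' j end).
exists (fun i => match fintype.split i with inl j => x j | inr j => x' j end); split.
  by move=> i j; case: fintype.split.
rewrite big_split_ord /=; congr (_ + _); apply: eq_bigr => i _.
  by rewrite (unsplitK (inl i)).
by rewrite (unsplitK (inr i)).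
Qed.

Lemma ideal_powerMl m a f : ideal_power I m f -> ideal_power I m (a * f).
Proof.
move=> [r [b [x [Ix ->]]]]; exists r, (fun i => a * b i), x; split => //.
by rewrite mulr_sumr; apply: eq_bigr => i _; rewrite mulrA.
Qed.

Lemma ideal_powerS m g f : I g -> ideal_power I m f -> ideal_power I m.+1 (g * f).
Proof.
move=> Ig [r [b [x [Ix ->]]]].
exists r, b, (fun i j => if unlift ord0 j is Some j' then x i j' else g); split.
  by move=> i j; case: unlift.
rewrite mulr_sumr; apply: eq_bigr => i _; rewrite big_ord_recl unlift_none mulrCA.
by congr (_ * (_ * _)); apply: eq_bigr => j _; rewrite liftK.
Qed.

Lemma ideal_power_leq m n f : (m <= n)%N -> ideal_power I n f -> ideal_power I m f.
Proof.
elim: n f => [|n IHn] f; first by rewrite leqn0 => /eqP ->.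
rewrite leq_eqVlt => /predU1P[-> // | ltmn] [r [b [x [Ix ->]]]]; apply: IHn => //.
exists r, (fun i => b i * x i ord0), (fun i j => x i (lift ord0 j)); split => //.
by apply: eq_bigr => i _; rewrite big_ord_recl mulrA.
Qed.

Lemma ideal_powerX m n g f : I g -> ideal_power I m f -> ideal_power I (n + m) (g ^+ n * f).
Proof.
move=> Ig If; elim: n => [|n IHn]; first by rewrite mul1r.
by rewrite exprS -mulrA addSn; apply: ideal_powerS.
Qed.

Lemma ideal_power_scale (J : set A) u m f :
  (forall g, I g -> J (u * g)) -> ideal_power I m f -> ideal_power J m (u ^+ m * f).
Proof.
move=> IJ [r [b [x [Ix ->]]]].
exists r, b, (fun i j => u * x i j); split => [i j|]; first by apply: IJ.
rewrite mulr_sumr; apply: eq_bigr => i _.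
by rewrite big_split /= prodr_const card_ord mulrCA.
Qed.

Lemma ideal_power_prodX n (g : 'I_n -> A) (k : 'I_n -> nat) :
  (forall i, I (g i)) -> ideal_power I (\sum_i k i) (\prod_i g i ^+ k i).
Proof.
elim: n g k => [|n IHn] g k Ig; first by rewrite big_ord0; apply: ideal_power0.
by rewrite !big_ord_recl; apply: ideal_powerX => //; apply: IHn.
Qed.

End IdealPower.

Lemma dvdXnP (K : fieldType) m (f : {poly K}) :
  reflect (forall j, (j < m)%N -> f`_j = 0) ('X^m %| f).
Proof.
apply: (iffP idP) => [/dvdpP[g ->] j ltj | f0]; first by rewrite coefMXn ltj.
rewrite -(poly_take_drop m f) dvdp_add ?dvdp_mull //.
suff -> : take_poly m f = 0 by rewrite dvdp0.
by apply/polyP => j; rewrite coef_take_poly coef0; case: ifP => // /f0.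
Qed.

(** * Order of vanishing along a linear subspace *)

Section OrderAlongLine.
Variables (K : fieldType) (charK : [pchar K] =i pred0) (n : nat).
Implicit Types (f u : {mpoly K[n]}) (p v : 'rV[K]_n) (L : {vspace 'rV[K]_n}).

Definition along p v : {mpoly K[n]} -> {poly K} :=
  mmap polyC (fun i => (p 0 i)%:P + v 0 i *: 'X).

HB.instance Definition _ p v := GRing.RMorphism.on (along p v).

Lemma along_horner p v f t : (along p v f).[t] = f.@[fun i => p 0 i + v 0 i * t].
Proof.
rewrite /along /mmap mevalE horner_sum; apply: eq_bigr => m _.
rewrite hornerM hornerC /mmap1 horner_prod; congr (_ * _); apply: eq_bigr => i _.
by rewrite horner_exp !hornerE.
Qed.

Lemma along_horner0 p v f : (along p v f).[0] = f.@[fun i => p 0 i].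
Proof. by rewrite along_horner; apply: meval_eq => i; rewrite mulr0 addr0. Qed.

Lemma along_horner1 p q f : (along p (q - p) f).[1] = f.@[fun i => q 0 i].
Proof.
by rewrite along_horner; apply: meval_eq => i; rewrite !mxE mulr1 subrKC.
Qed.

(** Order at least [m] at every point of [L], tested in all directions. On forms of a fixed degree
    these are visibly linear conditions on the coefficients, unlike membership in an ideal power. *)
Definition vanishes_along m L f := forall p v, p \in L -> 'X^m %| along p v f.

Definition vanishing_ideal L : set {mpoly K[n]} :=
  [set f | forall p, p \in L -> f.@[fun j => p 0 j] = 0].

Lemma vanishing_idealN L f : ~ vanishing_ideal L f ->
  exists2 p, p \in L & f.@[fun j => p 0 j] != 0.
Proof.
move=> nf; apply: contrapT => np; apply: nf => p Lp.
by apply/eqP/negPn/negP => fp; apply: np; exists p.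
Qed.

(** A point where [f] is nonzero and one where [g] is are joined by a line inside [L], on which the
    product of two nonzero univariate polynomials cannot vanish identically. *)
Lemma vanishing_ideal_prime L f g : vanishing_ideal L (f * g) ->
  vanishing_ideal L f \/ vanishing_ideal L g.
Proof.
move=> fg0; apply/or_asboolP; rewrite -[_ || _]negbK negb_or.
apply/andP => -[/asboolPn/vanishing_idealN[p Lp fp] /asboolPn/vanishing_idealN[q Lq gq]].
have /(poly_eq0_char0 charK)/eqP : forall t, (along p (q - p) (f * g)).[t] = 0.
  move=> t; rewrite along_horner -[RHS](fg0 (p + t *: (q - p))) ?memvD ?memvZ ?memvB //.
  by apply: meval_eq => i; rewrite !mxE mulrC.
rewrite rmorphM mulf_eq0 => /orP[/eqP f0|/eqP g0].
  by case/eqP: fp; rewrite -(along_horner0 p (q - p)) [X in X.[_]]f0 horner0.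
by case/eqP: gq; rewrite -(along_horner1 p) [X in X.[_]]g0 horner0.
Qed.

Lemma vanishes_along_power m L f : ideal_power (vanishing_ideal L) m f -> vanishes_along m L f.
Proof.
move=> If p v Lp; pose Q m (q : {poly K}) := is_true ('X^m %| q).
refine (@ideal_power_filtration {mpoly K[n]} {poly K} (along p v) Q _ m f _ _ _ _ _ If).
- by move=> m'; rewrite /Q dvdp0.
- by move=> q; rewrite /Q expr0 dvd1p.
- by move=> m' q q' dq dq'; apply: dvdp_add.
- by move=> m' m'' q q' dq dq'; rewrite /Q exprD dvdp_mul.
move=> g Ig; rewrite /Q expr1 -['X]subr0 -polyC0 dvdp_XsubCl /root along_horner0.
exact/eqP/Ig.
Qed.

(** The displacement [s] of the base point is treated as a second polynomial variable; finitely many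
    bad values of [s] can then be ignored. *)
Lemma coef_along_line p w v f j :
  exists q : {poly K}, forall s, q.[s] = (along (p + s *: w) v f)`_j.
Proof.
pose h i : {poly {poly K}} := ((p 0 i)%:P + w 0 i *: 'X)%:P + (v 0 i)%:P *: 'X.
exists (mmap (polyC \o polyC) h f)`_j => s.
suff <- : map_poly (horner_eval s) (mmap (polyC \o polyC) h f) = along (p + s *: w) v f.
  by rewrite coef_map.
rewrite /along /mmap rmorph_sum; apply: eq_bigr => m _.
rewrite rmorphM /= map_polyC /= [horner_eval _ _]hornerC /mmap1 rmorph_prod; congr (_ * _).
apply: eq_bigr => i _; rewrite rmorphXn; congr (_ ^+ _).
have evE q : horner_eval s q = q.[s] by [].
by rewrite /h rmorphD /= map_polyC map_polyZ map_polyX /= !evE !hornerE !mxE mulrC.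
Qed.

(** Where [u] is nonzero its restriction is prime to X and cancels. Any other point of [L] is joined
    to some [p0] with $u(p_0) \ne 0$; along this line the coefficient [q] vanishes off the roots of
    [w], hence identically. *)
Lemma vanishes_along_cancel m L u f :
  ~ vanishing_ideal L u -> vanishes_along m L (u * f) -> vanishes_along m L f.
Proof.
move=> /vanishing_idealN[p0 Lp0 up0] vuf p v Lp; apply/dvdXnP => j ltj.
have [q qE] := coef_along_line p (p0 - p) v f j.
pose w := along p (p0 - p) u.
have w0 : w != 0.
  by apply: contraNneq up0 => w0; rewrite -(along_horner1 p) -/w w0 horner0.
suff q0 : q = 0 by have := qE 0; rewrite q0 horner0 scale0r addr0.
have : q * w = 0.
  apply: (poly_eq0_char0 charK) => s; rewrite hornerM.
  have [ws|ws] := eqVneq w.[s] 0; first by rewrite ws mulr0.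
  rewrite qE; suff : 'X^m %| along (p + s *: (p0 - p)) v f.
    by move/dvdXnP => ->; rewrite ?mul0r.
  have := vuf (p + s *: (p0 - p)) v; rewrite memvD ?memvZ ?memvB // => /(_ isT).
  rewrite rmorphM Gauss_dvdpr //; apply: coprimep_expl.
  rewrite -['X]subr0 -polyC0 coprimep_sym coprimep_XsubC /root along_horner0.
  apply: contra ws => /eqP <-; rewrite along_horner.
  by apply/eqP/meval_eq => i; rewrite !mxE mulrC.
by move/eqP; rewrite mulf_eq0 (negPf w0) orbF => /eqP.
Qed.

End OrderAlongLine.

(** * Lines in special position *)

Section SpecialPosition.
Variables (K : fieldType) (charK : [pchar K] =i pred0).

Definition affine_row (x y z : K) : 'rV[K]_4 := \row_j affine_point x y z j.

Lemma dim_affine_line x y z (i : 'I_4) : i != ord_max ->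
  \dim <<[:: affine_row x y z; delta_mx 0%R i]>>%VS == 2%N.
Proof.
move=> ni; suff: free [:: affine_row x y z; delta_mx 0%R i] by rewrite /free => /eqP ->.
rewrite free_cons span_seq1 seq1_free; apply/andP; split.
  apply/negP => /vlineP[c /rowP/(_ ord_max)/eqP].
  by rewrite !mxE (eq_sym ord_max) (negPf ni) mulr0 oner_eq0.
by apply/eqP => /rowP/(_ i)/eqP; rewrite !mxE !eqxx oner_eq0.
Qed.

Definition affine_line x y z (i : 'I_4) (ni : i != ord_max) : line K :=
  exist (fun L : {vspace 'rV[K]_4} => \dim L == 2%N) _ (dim_affine_line x y z ni).

Lemma vanishing_ideal_affine_line x y z i ni t f :
  vanishing_ideal (sval (@affine_line x y z i ni)) f ->
  f.@[fun j => affine_point x y z j + t *+ (j == i)] = 0.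
Proof.
move=> /(_ (affine_row x y z + t *: delta_mx 0%R i)).
have -> : affine_row x y z + t *: delta_mx 0%R i \in sval (affine_line x y z ni).
  by rewrite /= memvD ?memvZ // memv_span // !inE eqxx ?orbT.
move=> /(_ isT) <-; apply: meval_eq => j.
by rewrite !mxE eqxx /= mulr_natr.
Qed.

(* The k^2 + a^2 lines z = c_i, x = b_l and y = e_j, x = b'_l of the affine chart. *)
Definition special_line k a (n : nat) : line K :=
  if (n < k * k)%N then
    @affine_line (n %% k)%:R 0 (n %/ k)%:R 1 isT
  else
    @affine_line (k + (n - k * k) %% a)%:R ((n - k * k) %/ a)%:R 0 2%:R isT.

Lemma special_line_degree s k a m d (f : {mpoly K[4]}) :
  (k * k + a * a <= s)%N -> f \is d.-homog -> f != 0 ->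
  (forall i : 'I_s, ideal_power (vanishing_ideal (sval (special_line k a i))) m f) ->
  ((k + a) * m <= d)%N.
Proof.
move=> les homf f0 If; have inj := natr_inj_char0 charK.
have injo n : injective (fun i : 'I_n => i%:R : K) by move=> i j /inj /val_inj.
(* The values 0, ..., k - 1 and k, ..., k + a - 1 of x keep the two families apart; in
   characteristic 0 they are distinct. *)
apply: (special_position_bound charK (b := fun l : 'I_k => l%:R) (c := fun i : 'I_k => i%:R)
   (b' := fun l : 'I_a => (k + l)%:R) (e := fun j : 'I_a => j%:R)) homf f0 _ _ => //.
- by move=> i j /inj /addnI /val_inj.
- by move=> l l'; apply/eqP => /inj; have := ltn_ord l; lia.
- move=> i l.
  have ltn : (i * k + l < k * k)%N by have := ltn_ord l; have := ltn_ord i; nia.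
  exists (vanishing_ideal (sval (special_line k a (i * k + l)))).
    exact: (If (Ordinal (leq_trans ltn (leq_trans (leq_addr _ _) les)))).
  rewrite /special_line ltn modnMDl divnMDl ?modn_small ?divn_small ?ltn_ord //;
    last by apply: leq_ltn_trans (ltn_ord i).
  rewrite addn0 => g /vanishing_ideal_affine_line Ig y; rewrite -(Ig y).
  by apply: meval_eq => j; case: j => [[|[|[|[|]]]] ltj] //=;
     rewrite ?mulr0n ?mulr1n ?addr0 ?add0r.
- move=> j l.
  have ltn : (j * a + l < a * a)%N by have := ltn_ord l; have := ltn_ord j; nia.
  have ltn' : (k * k + (j * a + l) < s)%N by lia.
  exists (vanishing_ideal (sval (special_line k a (k * k + (j * a + l))))).
    exact: (If (Ordinal ltn')).
  rewrite /special_line ltnNge leq_addr /= addKn modnMDl divnMDl ?modn_small ?divn_small ?ltn_ord //;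
    last by apply: leq_ltn_trans (ltn_ord j).
  rewrite addn0 => g /vanishing_ideal_affine_line Ig y; rewrite -(Ig isT y).
  by apply: meval_eq => i; case: i => [[|[|[|[|]]]] lti] //=;
     rewrite ?mulr0n ?mulr1n ?addr0 ?add0r.
Qed.

End SpecialPosition.

(** * Coordinates adapted to a linear subspace *)

Section AdaptedCoordinates.
Variables (K : fieldType) (charK : [pchar K] =i pred0) (n : nat).
Variable L : {vspace 'rV[K]_n}.

Let r : nat := \dim L.
Let r' : nat := \dim L^C.

Definition adapted_basis : (r + r').-tuple 'rV[K]_n :=
  [tuple of vbasis L ++ vbasis L^C].

Lemma adapted_basisP : basis_of fullv adapted_basis.
Proof.
rewrite -(addv_complf L); apply: cat_basis (vbasisP _) (vbasisP _).
by rewrite directvE /= dimv_disjoint_sum ?capv_compl.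
Qed.

Lemma adapted_basis_lshift (i : 'I_r) : adapted_basis`_(lshift r' i) = (vbasis L)`_i.
Proof. by rewrite nth_cat size_tuple /= ltn_ord. Qed.

(** The dual basis as linear forms; those indexed through [rshift] belong to the complement and cut
    out [L]. *)
Definition form (i : 'I_(r + r')) : {mpoly K[n]} :=
  \sum_j coord adapted_basis i (delta_mx 0 j) *: 'X_j.

Lemma form_eval i (x : 'rV[K]_n) : (form i).@[fun j => x 0 j] = coord adapted_basis i x.
Proof.
rewrite /form rmorph_sum [in RHS](row_sum_delta x) [RHS]linear_sum /=; apply: eq_bigr => j _.
by rewrite mevalZ mevalXU linearZ mulrC.
Qed.

Lemma form_vanishes i : vanishing_ideal L (form (rshift r i)).
Proof.
move=> x Lx; rewrite form_eval (coord_basis (vbasisP L) Lx) linear_sum big1 // => j _.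
rewrite linearZ /= -adapted_basis_lshift coord_free ?(basis_free adapted_basisP) //.
by rewrite eq_lrshift mulr0.
Qed.

Lemma form_homog i : form i \is 1.-homog.
Proof.
by apply: rpred_sum => j _; apply: rpredZ; rewrite dhomogX /= mdeg1.
Qed.

Lemma form_separates x : x \notin L -> exists g : {mpoly K[n]},
  [/\ vanishing_ideal L g, g \is 1.-homog & g.@[fun j => x 0 j] != 0].
Proof.
move=> nLx; apply: contrapT => nog; case/negP: nLx.
rewrite (coord_basis adapted_basisP (memvf x)) big_split_ord /= memvD //.
  apply: memv_suml => i _; rewrite memvZ // adapted_basis_lshift.
  by apply: vbasis_mem; rewrite mem_nth // size_tuple.
rewrite big1 ?mem0v // => i _.
have [-> | nz] := eqVneq (coord adapted_basis (rshift r i) x) 0; first by rewrite scale0r.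
case: nog; exists (form (rshift r i)); split; [exact: form_vanishes|exact: form_homog|].
by rewrite form_eval.
Qed.

Let subst (f : {mpoly K[n]}) : {mpoly K[r + r']} :=
  f \mPo [tuple \sum_(i < r + r') adapted_basis`_i 0 j *: 'X_i | j < n].

Lemma subst_eval f xi :
  (subst f).@[xi] = f.@[fun j => (\sum_i xi i *: adapted_basis`_i) 0 j].
Proof.
rewrite comp_mpoly_meval; apply: meval_eq => j.
rewrite tnth_mktuple rmorph_sum summxE /=; apply: eq_bigr => i _.
by rewrite mevalZ mevalXU mxE mulrC.
Qed.

Lemma substK f : subst f \mPo [tuple form i | i < r + r'] = f.
Proof.
apply/eqP; rewrite -subr_eq0; apply/eqP; apply: (mpoly_eq0_char0 charK) => v.
rewrite mevalB comp_mpoly_meval subst_eval; apply/eqP; rewrite subr_eq0; apply/eqP.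
apply: meval_eq => j.
have -> : v j = (\row_i v i) 0 j by rewrite mxE.
rewrite [in RHS](coord_basis adapted_basisP (memvf (\row_i v i))); congr (fun_of_matrix _ _ _).
apply: eq_bigr => i _; congr (_ *: _).
rewrite tnth_mktuple -form_eval; apply: meval_eq => k; by rewrite mxE.
Qed.

Let weight (m : 'X_{1..r + r'}) := (\sum_i m (rshift r i))%N.

(** On the line from [P] in [L] in the transverse direction [V], the coefficient of $t^w$ in [f] is
    the part of [subst f] of degree w in the transverse coordinates, evaluated at [xi]. For w < m it
    vanishes for all [xi], so that part is zero. *)
Lemma subst_coef0 m f mon : vanishes_along m L f -> (weight mon < m)%N -> (subst f)@_mon = 0.
Proof.
move=> vf ltm; set F := subst f.
pose G := \sum_(l <- msupp F) (F@_l * (weight l == weight mon)%:R) *: 'X_[l].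
have G0 : G = 0.
  apply: (mpoly_eq0_char0 charK) => xi.
  pose P := \sum_i xi (lshift r' i) *: adapted_basis`_(lshift r' i).
  pose V := \sum_i xi (rshift r i) *: adapted_basis`_(rshift r i).
  pose q := \sum_(l <- msupp F) (F@_l * \prod_i xi i ^+ l i) *: 'X^(weight l).
  have qE : along P V f = q.
    apply/eqP; rewrite -subr_eq0; apply/eqP; apply: (poly_eq0_char0 charK) => t.
    rewrite hornerD hornerN along_horner; apply/eqP; rewrite subr_eq0; apply/eqP.
    pose xit i := match fintype.split i with inl j => xi (lshift r' j) | inr j => xi (rshift r j) * t end.
    transitivity (F.@[xit]).
      rewrite subst_eval; apply: meval_eq => j.
      rewrite big_split_ord /= mxE; congr (_ + _).
        by rewrite !summxE; apply: eq_bigr => i _; rewrite /xit (unsplitK (inl i)).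
      rewrite !summxE mulr_suml; apply: eq_bigr => i _.
      by rewrite /xit (unsplitK (inr i)) !mxE mulrAC.
    rewrite mevalE /q horner_sum; apply: eq_bigr => l _.
    rewrite hornerZ hornerXn -mulrA; congr (_ * _).
    rewrite !big_split_ord /= -mulrA; congr (_ * _).
      by apply: eq_bigr => i _; rewrite /xit (unsplitK (inl i)).
    rewrite -prodrXr -big_split /=.
    by apply: eq_bigr => i _; rewrite /xit (unsplitK (inr i)) exprMn.
  have LP : P \in L.
    apply: memv_suml => i _; rewrite memvZ // adapted_basis_lshift.
    by apply: vbasis_mem; rewrite mem_nth // size_tuple.
  have /dvdXnP/(_ _ ltm) := vf P V LP; rewrite qE coef_sum => q0.
  rewrite -[RHS]q0 rmorph_sum /=; apply: eq_bigr => l _.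
  by rewrite mevalZ mevalX coefZ coefXn (eq_sym (weight mon)) mulrAC.
have [mf|] := boolP (mon \in msupp F); last exact: memN_msupp_eq0.
have := congr1 (mcoeff mon) G0; rewrite mcoeff0 raddf_sum /= => <-.
rewrite (bigD1_seq mon) ?msupp_uniq //= mcoeffZ mcoeffX !eqxx !mulr1 big1_seq ?addr0 //.
by move=> l /andP[nl _]; rewrite mcoeffZ mcoeffX (negPf nl) mulr0.
Qed.

(** In adapted coordinates every monomial of [f] has transverse degree at least [m], so it is a
    multiple of a product of [m] forms vanishing on [L]. *)
Lemma vanishes_along_ideal_power m f :
  vanishes_along m L f -> ideal_power (vanishing_ideal L) m f.
Proof.
move=> vf; rewrite -(substK f) comp_mpolyE big_seq.
elim/big_rec: _ => [|mon x monF Ix]; first exact: ideal_power_zero.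
apply: ideal_powerD => //; rewrite -mul_mpolyC; apply: ideal_powerMl.
rewrite big_split_ord /=; apply: ideal_powerMl.
have lem : (m <= weight mon)%N.
  rewrite leqNgt; apply: contraL monF => ltm.
  by rewrite mcoeff_msupp (subst_coef0 vf ltm) eqxx.
apply: ideal_power_leq lem _.
rewrite (eq_bigr (fun i => form (rshift r i) ^+ mon (rshift r i))); last first.
  by move=> i _; rewrite tnth_mktuple.
by apply: ideal_power_prodX => i; apply: form_vanishes.
Qed.

End AdaptedCoordinates.

(** * Symbolic powers *)

Lemma pred_setE (T : Type) (A : set T) x : (x \in [pred y in A]) = (x \in A).
Proof. by []. Qed.

Section SymbolicPower.
Variables (K : fieldType) (charK : [pchar K] =i pred0) (s : nat) (L : 'I_s -> line K).

Let V i := vanishing_ideal (sval (L i)).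

Lemma vanishing_ideal1 n (M : {vspace 'rV[K]_n}) : ~ vanishing_ideal M 1.
Proof. by move/(_ 0 (mem0v _)); rewrite meval1 => /eqP; rewrite oner_eq0. Qed.

Lemma vanishing_ideal_sub n (M N : {vspace 'rV[K]_n}) :
  (vanishing_ideal M `<=` vanishing_ideal N)%classic -> (N <= M)%VS.
Proof.
move=> MN; apply/subvP => x Nx; apply/negPn/negP => /form_separates[g [Mg _]].
by rewrite (MN g Mg x Nx) eqxx.
Qed.

Lemma line_eq i j : (sval (L i) <= sval (L j))%VS -> sval (L i) = sval (L j).
Proof.
move=> le; apply/eqP; rewrite eqEdim le /=.
by rewrite (eqP (svalP (L i))) (eqP (svalP (L j))).
Qed.

(** A product over [j] of linear forms vanishing on [L j] but not identically on [L i]; lines may be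
    repeated, and those equal to [L i] contribute 1. *)
Lemma isolating_form i :
  exists u, (forall j, sval (L j) != sval (L i) -> V j u) /\ ~ V i u.
Proof.
have /choice[u uP] j : exists u, (sval (L j) != sval (L i) -> V j u) /\ ~ V i u.
  have [_|ne] := eqVneq (sval (L j)) (sval (L i)).
    by exists 1; split=> //; apply: vanishing_ideal1.
  have /subvPn[x Ix nJx] : ~~ (sval (L i) <= sval (L j))%VS.
    by apply: contra ne => /line_eq ->.
  by have [g [Jg _ gx]] := form_separates nJx; exists g; split=> // /(_ x Ix)/eqP; apply/negP.
exists (\prod_j u j); split => [j ne x Lx|].
  by rewrite rmorph_prod (bigD1 j) //= ((uP j).1 ne x Lx) mul0r.
elim/big_ind: _ => [|f g nf ng /(vanishing_ideal_prime charK)[]|j _] //.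
  exact: vanishing_ideal1.
exact: (uP j).2.
Qed.

Lemma vanishing_ideal_closed n (M : {vspace 'rV[K]_n}) :
  idealr_closed [pred x in vanishing_ideal M].
Proof.
split; first by rewrite pred_setE; apply/mem_set => p _; rewrite meval0.
  by rewrite pred_setE; apply/negP => /set_mem; apply: vanishing_ideal1.
move=> a f g; rewrite !pred_setE => /set_mem Mf /set_mem Mg; apply/mem_set => p Mp.
by rewrite mevalD mevalM Mf // Mg // mulr0 addr0.
Qed.

Lemma lines_idealMl f g : lines_ideal L f -> lines_ideal L (g * f).
Proof. by move=> If i p Lp; rewrite mevalM (If i p Lp) mulr0. Qed.

Lemma isolating_colon i u :
  (forall j, sval (L j) != sval (L i) -> V j u) -> ~ V i u ->
  V i = [set g | lines_ideal L (g * u)]%classic.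
Proof.
move=> uV nuV; apply/seteqP; split => [g Vg j p Lp|g /= Ig].
  rewrite mevalM; have [e|ne] := eqVneq (sval (L j)) (sval (L i)).
    by rewrite Vg ?mul0r // -e.
  by rewrite (uV j ne p Lp) mulr0.
by have [] := vanishing_ideal_prime charK (Ig i).
Qed.

Lemma vanishing_ideal_associated i : associated_prime (lines_ideal L) (V i).
Proof.
have [u [uV nuV]] := isolating_form i.
split; first exact: vanishing_ideal_closed.
  move=> f g; rewrite !pred_setE => /set_mem /(vanishing_ideal_prime charK)[H|H];
    by apply/orP; (left; exact/mem_set) || (right; exact/mem_set).
by exists u; apply: isolating_colon.
Qed.

(** If $P = (I : h)$ with [h] outside [V j], then P lies in [V j]. Being prime and containing the
    product of all the [V i], P contains some [V i]; an inclusion between ideals of lines is an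
    equality. *)
Lemma associated_prime_line P : associated_prime (lines_ideal L) P -> exists i, P = V i.
Proof.
case=> [[P0 P1 Padd] Pprime [h hP]].
have nIh : ~ lines_ideal L h.
  move=> Ih; case/negP: P1; rewrite pred_setE; apply/mem_set; rewrite hP /=.
  by rewrite mul1r.
have [j nVh] : exists j, ~ V j h.
  by apply: contrapT => nj; apply: nIh => i; apply: contrapT => nVi; apply: nj; exists i.
have PV : (P `<=` V j)%classic.
  by rewrite hP => g /= /(_ j) /(vanishing_ideal_prime charK)[].
have Pmul f g : P (f * g) -> P f \/ P g.
  move=> Pfg; have := Pprime f g; rewrite !pred_setE => /(_ (mem_set Pfg)).
  by case/orP => /set_mem; [left|right].
have [i VP] : exists i, (V i `<=` P)%classic.
  apply: contrapT => ni.
  have /choice[g gP] i : exists g, V i g /\ ~ P g.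
    apply: contrapT => ng; apply: ni; exists i => g Vg.
    by apply: contrapT => nPg; apply: ng; exists g.
  suff : ~ P (\prod_i g i).
    apply; rewrite hP /= mulrC; apply: lines_idealMl => i p Lp.
    by rewrite rmorph_prod (bigD1 i) //= ((gP i).1 p Lp) mul0r.
  elim/big_ind: _ => [|f f' nf nf' /Pmul[]|i _] //; last exact: (gP i).2.
  by move=> P1'; case/negP: P1; rewrite pred_setE; apply/mem_set.
exists j; apply/seteqP; split => //.
have := vanishing_ideal_sub (subset_trans VP PV) => /line_eq e.
by rewrite /V e.
Qed.

(** In one direction the denominator lies outside [V i] and is cancelled by [vanishes_along_cancel].
    In the other, [f] lies in the m-th power of [V i], and an isolating [u] puts [u ^+ m * f] into
    the m-th power of the ideal of all the lines. *)
Lemma symbolic_powerP m f :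
  symbolic_power (lines_ideal L) m f <-> forall i, vanishes_along m (sval (L i)) f.
Proof.
split=> [If i|vf P /associated_prime_line[i ->]].
  have [a [u [Ia nu fE]]] := If _ (vanishing_ideal_associated i).
  apply: (vanishes_along_cancel charK nu).
  have u0 : tofrac u != 0.
    by rewrite tofrac_eq0; apply: contra_notN nu => /eqP -> p _; rewrite meval0.
  have -> : u * f = a.
    by apply/eqP; rewrite -tofrac_eq tofracM fE mulrC divfK.
  apply: vanishes_along_power; have [r [b [g [Ig ->]]]] := Ia.
  by exists r, b, g; split=> // k l; apply: Ig.
have [u [uV nuV]] := isolating_form i.
have Iu := isolating_colon uV nuV.
exists (u ^+ m * f), (u ^+ m); split.
- apply: (ideal_power_scale (I := V i)); last exact: (vanishes_along_ideal_power charK).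
  by move=> g; rewrite Iu mulrC.
- elim: m {vf} => [|m IHm]; first exact: vanishing_ideal1.
  by rewrite exprS => /(vanishing_ideal_prime charK)[].
rewrite tofracM mulrAC divff ?mul1r // tofrac_eq0 expf_neq0 //.
by apply/negP => /eqP u0; apply: nuV; rewrite u0 => p _; rewrite meval0.
Qed.

End SymbolicPower.

(** * The vanishing condition is closed *)

Section PluckerSpan.
Variable K : fieldType.

Lemma row_free_pair n (u v : 'rV[K]_n) : free [:: u; v] -> row_free (col_mx u v).
Proof.
rewrite free_cons span_seq1 seq1_free => /andP[nu v0].
rewrite -kermx_eq0; apply/rowV0P => w /sub_kermxP.
rewrite -(hsubmxK w) mul_row_col (mx11_scalar (lsubmx w)) (mx11_scalar (rsubmx w)) !mul_scalar_mx.
move: (lsubmx w 0 0) (rsubmx w 0 0) => a b e.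
have a0 : a = 0.
  apply: contraNeq nu => a0; apply/vlineP; exists (- (b / a)).
  apply: (scalerI a0); rewrite scalerA mulrN mulrC divfK // scaleNr.
  by apply/eqP; rewrite -addr_eq0 e.
have b0 : b = 0.
  by move/eqP: e; rewrite a0 scale0r add0r scaler_eq0 (negPf v0) orbF => /eqP.
by rewrite a0 b0 !raddf0 row_mx0.
Qed.

Lemma mul_wedge n (u v y : 'rV[K]_n) :
  y *m (u^T *m v - v^T *m u) = (y *m u^T) 0 0 *: v - (y *m v^T) 0 0 *: u.
Proof.
rewrite mulmxBr !mulmxA {1}(mx11_scalar (y *m u^T)) {1}(mx11_scalar (y *m v^T)).
by rewrite !mul_scalar_mx.
Qed.

(** The points of a line are thus linear in its Pluecker coordinates, with [y] as a free parameter
    that does not depend on the line. *)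
Lemma wedge_span n (M : {vspace 'rV[K]_n}) u v p : basis_of M [:: u; v] ->
  (p \in M <-> exists y, p = y *m (u^T *m v - v^T *m u)).
Proof.
move=> /andP[/eqP spanM freeM]; split; last first.
  case=> y ->; rewrite mul_wedge -spanM rpredB ?rpredZ // memv_span // !inE eqxx ?orbT //.
rewrite -spanM span_cons span_seq1 => /memv_addP[_ /vlineP[a ->] [_ /vlineP[b ->] ->]].
have /row_freeP[B MB] := row_free_pair freeM.
(* The right inverse [B] yields [y] with products b with [u] and -a with [v], whence a u + b v. *)
pose y := row_mx b%:M (- a%:M) *m B^T : 'rV_n.
have : y *m (col_mx u v)^T = row_mx b%:M (- a%:M).
  by rewrite -mulmxA -trmx_mul MB trmx1 mulmx1.
rewrite tr_col_mx mul_mx_row => /eq_row_mx[yu yv].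
by exists y; rewrite mul_wedge yu yv !mxE eqxx scaleNr opprK addrC.
Qed.

Lemma plucker_basis (L : line K) :
  basis_of (sval L) [:: (vbasis (sval L))`_0; (vbasis (sval L))`_1].
Proof.
have := vbasisP (sval L); congr (is_true (basis_of _ _)).
have : size (vbasis (sval L)) = 2%N by rewrite size_tuple (eqP (svalP L)).
by case: (tval (vbasis _)) => [|x [|y []]].
Qed.

Lemma plucker_span (L : line K) p :
  p \in sval L <-> exists y, p = y *m plucker L.
Proof. exact: wedge_span (plucker_basis L). Qed.

End PluckerSpan.

Section CommonKernel.
Variables (K : fieldType) (N : nat) (C : Type) (phi : C -> 'rV[K]_N).

(** The index type may be infinite. Without a common solution, a nonzero vector killed by the rows
    chosen so far violates a further condition, whose row is independent of them; N such rows have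
    nonzero determinant. *)
Lemma common_kernel_det :
  (exists2 v : 'cV[K]_N, v != 0 & forall c, phi c *m v = 0) <->
  (forall g : 'I_N -> C, \det (\matrix_i phi (g i)) = 0).
Proof.
split=> [[v v0 phiv] g | det0].
  apply/eqP; apply/negPn/negP; rewrite -unitfE -unitmxE => /mulKmx K1.
  case/eqP: v0; rewrite -(K1 _ v).
  have -> : (\matrix_i phi (g i)) *m v = 0; last exact: mulmx0.
  by apply/row_matrixP => i; rewrite row_mul rowK phiv row0.
apply: contrapT => nov.
suff H r : (r <= N)%N -> exists g : 'I_r -> C, row_free (\matrix_i phi (g i)).
  have [g] := H N (leqnn N).
  by rewrite row_free_unit unitmxE det0 unitr0.
elim: r => [_|r IHr ltrN].
  have g0 : 'I_0 -> C by case.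
  by exists g0; rewrite /row_free; have := rank_leq_row (\matrix_i phi (g0 i)); rewrite leqn0.
have [g freeg] := IHr (ltnW ltrN); set M := \matrix_i phi (g i) in freeg.
have [v v0 Mv] : exists2 v : 'cV[K]_N, v != 0 & M *m v = 0.
  have /rowV0Pn[w /sub_kermxP wM w0] : kermx M^T != 0.
    rewrite kermx_eq0 /row_free mxrank_tr.
    by apply: contraTneq ltrN => eN; rewrite -leqNgt -eN rank_leq_row.
  exists w^T; first by rewrite trmx_eq0.
  by apply: trmx_inj; rewrite trmx_mul trmxK wM trmx0.
have [c phic] : exists c, phi c *m v != 0.
  apply: contrapT => noc; apply: nov; exists v => // c.
  by apply/eqP/negPn/negP => ?; apply: noc; exists c.
exists (fun i : 'I_(1 + r) => if fintype.split i is inr j then g j else c).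
have -> : \matrix_(i < 1 + r) phi (if fintype.split i is inr j then g j else c) = col_mx (phi c) M.
  apply/row_matrixP => i; rewrite rowK; case: splitP => j ij.
    have -> : i = lshift r j by apply: val_inj.
    by rewrite rowKu row_id.
  have -> : i = rshift 1 j by apply: val_inj.
  by rewrite rowKd rowK.
rewrite -kermx_eq0; apply/rowV0P.
change (forall w : 'rV_(1 + r), (w <= kermx (col_mx (phi c) M))%MS -> w = 0) => w /sub_kermxP.
rewrite -(hsubmxK w) mul_row_col => e.
have l0 : lsubmx w = 0.
  have : (lsubmx w *m phi c + rsubmx w *m M) *m v = 0 by rewrite e mul0mx.
  rewrite mulmxDl -!mulmxA Mv mulmx0 addr0 (mx11_scalar (lsubmx w)) mul_scalar_mx.
  by move/eqP; rewrite scaler_eq0 (negPf phic) orbF => /eqP ->; rewrite raddf0.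
have r0 : rsubmx w = 0.
  by apply: (row_free_inj freeg); move: e; rewrite l0 mul0mx add0r => ->; rewrite mul0mx.
by rewrite l0 r0 row_mx0.
Qed.

End CommonKernel.

Section GroupDegree.
Variables (K : fieldType) (s : nat).

Definition group_degree (i : 'I_s) (mon : 'X_{1..s * (4 * 4)}) : nat :=
  (\sum_(j < 4 * 4) mon (mxvec_index i j))%N.

Lemma group_degree0 i : group_degree i 0%MM = 0%N.
Proof. by rewrite /group_degree big1 // => j _; rewrite mnm0E. Qed.

Lemma group_degreeD i :
  {morph group_degree i : m1 m2 / (m1 + m2)%MM >-> (m1 + m2)%N}.
Proof.
by move=> m1 m2; rewrite /group_degree -big_split; apply: eq_bigr => j _; rewrite mnmDE.
Qed.

HB.instance Definition _ i :=
  isMeasure.Build _ (group_degree i) (group_degree0 i) (group_degreeD i).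

Lemma mxvec_index_inj m n : injective (fun ij : 'I_m * 'I_n => mxvec_index ij.1 ij.2).
Proof. by move=> [i j] [i' j'] /cast_ord_inj /enum_rank_inj. Qed.

Lemma group_degree_var i i' j : group_degree i U_(mxvec_index i' j) = (i == i').
Proof.
rewrite /group_degree; have [<-|ne] := eqVneq i i'.
  rewrite (bigD1 j) //= mnm1E eqxx big1 // => j' ne.
  rewrite mnm1E; case: eqP => // e; case/eqP: ne.
  by have [] := @mxvec_index_inj _ _ (i, j) (i, j') e.
rewrite big1 // => j' _; rewrite mnm1E; case: eqP => // e; case/eqP: ne.
by have [] := @mxvec_index_inj _ _ (i', j) (i, j') e.
Qed.

(* For b = 1, homogeneous of total degree D in the i-th group and the outer variable
   together; for b = 0, of degree 0 in the i-th group. *)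
Definition bihomog i (b D : nat) (q : {poly {mpoly K[s * (4 * 4)]}}) :=
  forall l, q`_l \is (b * (D - l)).-homog for (group_degree i) /\ ((D < l)%N -> q`_l = 0).

Lemma bihomogM i b D D' q q' :
  bihomog i b D q -> bihomog i b D' q' -> bihomog i b (D + D') (q * q').
Proof.
move=> hq hq' l; split=> [|ltl]; rewrite coefM.
  apply: rpred_sum => j _.
  have [ltj|lej] := ltnP D j; first by rewrite (hq j).2 // mul0r rpred0.
  have [ltj'|lej'] := ltnP D' (l - j); first by rewrite (hq' (l - j)%N).2 // mulr0 rpred0.
  have -> : (b * (D + D' - l) = b * (D - j) + b * (D' - (l - j)))%N.
    by rewrite -mulnDr; congr (_ * _)%N; have := ltn_ord j; lia.
  by apply: dhomogM; [exact: (hq j).1 | exact: (hq' _).1].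
apply: big1 => j _; have [ltj|lej] := ltnP D j; first by rewrite (hq j).2 // mul0r.
by rewrite (hq' _).2 ?mulr0 //; lia.
Qed.

Lemma bihomog1 i b : bihomog i b 0 1.
Proof.
move=> l; rewrite coef1; split; last by case: l.
by rewrite sub0n muln0; case: eqP => _; rewrite ?dhomog1 ?rpred0.
Qed.

Lemma bihomogX i b D q n : bihomog i b D q -> bihomog i b (D * n) (q ^+ n).
Proof.
move=> hq; elim: n => [|n IHn]; first by rewrite muln0; apply: bihomog1.
by rewrite mulnS exprS; apply: bihomogM.
Qed.

(** Coordinate [a] of $y P_i + X z$, with variables in place of the Pluecker matrix $P_i$ of the
    i-th line. *)
Definition generic_coord (i : 'I_s) (y z : 'rV[K]_4) (a : 'I_4) : {poly {mpoly K[s * (4 * 4)]}} :=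
  (\sum_b y 0 b *: 'X_(mxvec_index i (mxvec_index b a)))%:P + (z 0 a)%:MP *: 'X.

Definition generic_along i y z (mn : 'X_{1..4}) := \prod_a generic_coord i y z a ^+ mn a.

Lemma generic_coord_bihomog i0 i y z a : bihomog i0 (i0 == i) 1 (generic_coord i y z a).
Proof.
move=> l; rewrite coefD coefC coefZ coefX; split; last by case: l => [|[]] // l _; rewrite mulr0 addr0.
case: l => [|[|l]] /=.
- rewrite mulr0 addr0; apply: rpred_sum => b _; apply: rpredZ.
  by rewrite dhomogX /= group_degree_var muln1.
- by rewrite add0r mulr1 muln0 -[_%:MP]mulr1 mul_mpolyC; apply: rpredZ; apply: dhomog1.
by rewrite mulr0 addr0 rpred0.
Qed.

Lemma generic_along_bihomog i0 i y z mn :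
  bihomog i0 (i0 == i) (mdeg mn) (generic_along i y z mn).
Proof.
rewrite mdegE /generic_along; elim/big_rec2: _ => [|a D q _ hq]; first exact: bihomog1.
apply: bihomogM => //.
by have := bihomogX (mn a) (generic_coord_bihomog i0 i y z a); rewrite mul1n.
Qed.

Lemma generic_alongE (L : 'I_s -> line K) i y z mn :
  map_poly (meval (plucker_coords L)) (generic_along i y z mn) =
  along (y *m plucker (L i)) z 'X_[mn].
Proof.
rewrite /generic_along rmorph_prod /along mmapX /mmap1; apply: eq_bigr => a _.
rewrite rmorphXn rmorphD /= map_polyC map_polyZ map_polyX /= mevalC; congr ((_%:P + _) ^+ _).
rewrite rmorph_sum mxE /=; apply: eq_bigr => b _.
rewrite [LHS]mevalZ.
by rewrite mevalXU /plucker_coords mxvecE mxE mxvecE.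
Qed.

Lemma dhomog_det i n (A : 'M[{mpoly K[s * (4 * 4)]}]_n) (d : 'I_n -> nat) :
  (forall r c, A r c \is (d r).-homog for (group_degree i)) ->
  \det A \is (\sum_r d r)%N.-homog for (group_degree i).
Proof.
move=> hA; apply: rpred_sum => p _; rewrite rpredMsign.
by elim/big_rec2: _ => [|r x y _ hy]; [apply: dhomog1 | apply: dhomogM].
Qed.

End GroupDegree.

Section VanishingLocus.
Variables (K : fieldType) (s t m : nat).

Definition vanishing_locus : set ('I_s -> line K) :=
  [set L | exists f : {mpoly K[4]},
     [/\ f \is t.-homog, f != 0 & forall i, vanishes_along m (sval (L i)) f]].

Let N := #|[pred mn : 'X_{1..4 < t.+1} | mdeg mn == t]|.
Let mon (k : 'I_N) : 'X_{1..4} := enum_val k.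

Lemma mdeg_mon k : mdeg (mon k) = t.
Proof. by have := enum_valP k; rewrite inE => /eqP. Qed.

Lemma mon_inj : injective mon.
Proof. by move=> k l e; apply: enum_val_inj; apply: val_inj. Qed.

Lemma mon_surj mn : mdeg mn = t -> exists k, mon k = mn.
Proof.
move=> dmn; have lt : (mdeg mn < t.+1)%N by rewrite dmn.
have mnA : BMultinom lt \in [pred mn : 'X_{1..4 < t.+1} | mdeg mn == t] by rewrite inE /= dmn.
by exists (enum_rank_in mnA (BMultinom lt)); rewrite /mon enum_rankK_in.
Qed.

Let formOf (v : 'cV[K]_N) : {mpoly K[4]} := \sum_k v k 0 *: 'X_[mon k].

Lemma formOf_homog v : formOf v \is t.-homog.
Proof.
by apply: rpred_sum => k _; apply: rpredZ; rewrite dhomogX /= mdeg_mon.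
Qed.

Lemma coef_formOf v k : (formOf v)@_(mon k) = v k 0.
Proof.
rewrite /formOf raddf_sum (bigD1 k) //= mcoeffZ mcoeffX eqxx mulr1 big1 ?addr0 // => l nl.
by rewrite mcoeffZ mcoeffX (inj_eq mon_inj) (negPf nl) mulr0.
Qed.

Lemma homog_formOf f : f \is t.-homog -> f = formOf (\col_k f@_(mon k)).
Proof.
move=> hf; apply/mpolyP => mn; have [e|ne] := eqVneq (mdeg mn) t.
  by have [k <-] := mon_surj e; rewrite coef_formOf mxE.
by rewrite (dhomog_nemf_coeff hf) // (dhomog_nemf_coeff (formOf_homog _)).
Qed.

(** One linear condition on a form: a line, a point on it given by [y], a direction, and the index
    of a coefficient below [m]. *)
Let cond := ('I_s * ('rV[K]_4 * 'rV[K]_4) * 'I_m)%type.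

Let row_of (L : 'I_s -> line K) (c : cond) : 'rV[K]_N :=
  \row_k (along (c.1.2.1 *m plucker (L c.1.1)) c.1.2.2 'X_[mon k])`_(c.2).

Lemma row_of_mul L c v :
  row_of L c *m v = ((along (c.1.2.1 *m plucker (L c.1.1)) c.1.2.2 (formOf v))`_(c.2))%:M.
Proof.
apply/matrixP => i j; rewrite !ord1 !mxE mulr1n rmorph_sum coef_sum; apply: eq_bigr => k _.
by rewrite mxE -mul_mpolyC rmorphM /= /along mmapC coefCM mulrC.
Qed.

Lemma vanishing_locusP L : vanishing_locus L <->
  exists2 v : 'cV[K]_N, v != 0 & forall c, row_of L c *m v = 0.
Proof.
split=> [[f [hf f0 vf]] | [v v0 vv]].
  exists (\col_k f@_(mon k)).
    by apply: contraNneq f0 => v0; rewrite (homog_formOf hf) v0 /formOf big1 // => k _;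
      rewrite mxE scale0r.
  move=> [[i [y z]] j]; rewrite row_of_mul -homog_formOf //=.
  have Ly : y *m plucker (L i) \in sval (L i) by apply/plucker_span; exists y.
  by have /dvdXnP/(_ j (ltn_ord j)) -> := vf i _ z Ly; rewrite raddf0.
exists (formOf v); split; first exact: formOf_homog.
  apply: contraNneq v0 => f0; apply/eqP/colP => k.
  by rewrite -coef_formOf f0 mcoeff0 mxE.
move=> i p z /plucker_span[y ->]; apply/dvdXnP => j ltj.
have := vv ((i, (y, z)), Ordinal ltj); rewrite row_of_mul /=.
by move=> /matrixP/(_ 0 0); rewrite !mxE mulr1n.
Qed.

(** The equations are the maximal minors of the system of all conditions. A row for the i-th line
    and the coefficient of index j has degree t - j in the variables of that line and 0 in the
    others, so each minor is multihomogeneous. *)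
Theorem vanishing_locus_closed : zariski_closed vanishing_locus.
Proof.
pose D (g : 'I_N -> cond) : {mpoly K[s * (4 * 4)]} := \det (\matrix_(r, k)
  (generic_along (g r).1.1 (g r).1.2.1 (g r).1.2.2 (mon k))`_((g r).2)).
have D_eval L g : (D g).@[plucker_coords L] = \det (\matrix_r row_of L (g r)).
  rewrite /D -det_map_mx; congr (\det _); apply/matrixP => r k.
  by rewrite !mxE -generic_alongE coef_map.
exists (range D); split => [_ [g _ <-] i|].
  exists (\sum_r (i == (g r).1.1) * (t - (g r).2))%N; apply: (@dhomog_mf _ _ (group_degree i)).
  apply: dhomog_det => r k; rewrite mxE.
  by have := (generic_along_bihomog i (g r).1.1 (g r).1.2.1 (g r).1.2.2 (mon k) (g r).2).1;
     rewrite mdeg_mon.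
apply/seteqP; split => L.
  by move=> /vanishing_locusP/common_kernel_det d0 _ [g _ <-]; rewrite D_eval d0.
move=> /= d0; apply/vanishing_locusP/common_kernel_det => g.
by rewrite -D_eval d0 //; exists g.
Qed.

End VanishingLocus.

(** * Countable unions of proper closed sets *)

Section Avoidance.
Variables (K : fieldType) (uncountableK : ~ countable [set: K]).

Lemma avoid_roots (p : nat -> {poly K}) :
  (forall n, p n != 0) -> exists t, forall n, (p n).[t] != 0.
Proof.
move=> p0; apply: contrapT => not; apply: uncountableK.
have -> : [set: K] = \bigcup_n [set t | (p n).[t] = 0].
  apply/esym/seteqP; split => // t _; apply: contrapT => nt; apply: not; exists t => n.
  by apply/eqP => pt; apply: nt; exists n.
apply: bigcup_countable => // n _; apply: finite_set_countable.
have [rs rsP] : exists rs : seq K, forall t, (p n).[t] = 0 -> t \in rs.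
  apply: contrapT => nors.
  have H k : exists rs : seq K, [/\ size rs = k, uniq rs & all (root (p n)) rs].
    elim: k => [|k [rs [srs urs rrs]]]; first by exists [::].
    apply: contrapT => nork; apply: nors; exists rs => t pt.
    apply/negPn/negP => nt; apply: nork; exists (t :: rs); split => /=.
    - by rewrite srs.
    - by rewrite nt.
    - by rewrite rrs /root pt eqxx.
  have [rs [srs urs rrs]] := H (size (p n)).
  by have := max_poly_roots (p0 n) rrs urs; rewrite srs ltnn.
by apply: sub_finite_set (finite_seq rs) => t /rsP.
Qed.

Definition update (I : eqType) (c : I -> K) j t : I -> K := fun i => if i == j then t else c i.

Lemma update_id (I : eqType) (c : I -> K) j : update c j (c j) = c.
Proof. by apply: funext => i; rewrite /update; case: eqP => [->|]. Qed.

(** Coordinates are fixed one at a time. The invariant is that those chosen extend, for each n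
    separately, to a point where [g n] is nonzero; the next value has to avoid the roots of
    countably many nonzero polynomials. *)
Lemma avoid_zeros (I : finType) (g : nat -> (I -> K) -> K) :
  (forall n c j, exists q : {poly K}, forall t, q.[t] = g n (update c j t)) ->
  (forall n, exists c, g n c != 0) -> exists c, forall n, g n c != 0.
Proof.
move=> gpoly gn0.
suff [c cP] : exists c, forall n, exists2 p, (forall i, i \in enum I -> p i = c i) & g n p != 0.
  exists c => n; have [p pc gp] := cP n.
  by rewrite (_ : c = p) //; apply: funext => i; rewrite pc // mem_enum.
elim: (enum I) => [|j l [c cP]].
  by exists (fun=> 0) => n; have [p gp] := gn0 n; exists p.
have [jl|njl] := boolP (j \in l).
  by exists c => n; have [p pc gp] := cP n; exists p => // i; rewrite inE => /predU1P[->|]; apply: pc.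
have /choice[p pP] : forall n, exists p, (forall i, i \in l -> p i = c i) /\ g n p != 0.
  by move=> n; have [p pc gp] := cP n; exists p.
have /choice[q qP] : forall n, exists q : {poly K}, forall t, q.[t] = g n (update (p n) j t).
  by move=> n; apply: gpoly.
have q0 n : q n != 0.
  apply: contraNneq (pP n).2 => q0.
  by have := qP n (p n j); rewrite q0 horner0 update_id => <-.
have [t tP] := avoid_roots q0.
exists (update c j t) => n; exists (update (p n) j t); last by rewrite -qP.
move=> i; rewrite inE /update; case: eqP => //= _ il; exact: (pP n).1.
Qed.

Section WedgeParametrization.
Variable s : nat.
Implicit Type c : 'I_s * (bool * 'I_4) -> K.

Definition wedge (u v : 'rV[K]_4) : 'M[K]_4 := u^T *m v - v^T *m u.

(** Tuples of lines are parametrized by arbitrary pairs of vectors, an affine space in which values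
    can be chosen coordinate by coordinate; the boolean tells the two vectors apart. *)
Definition wedge_coords c : 'I_(s * (4 * 4)) -> K := fun k =>
  mxvec (\matrix_i mxvec (wedge (\row_a c (i, (false, a))) (\row_a c (i, (true, a))))) 0 k.

Lemma wedge_coordsE c i a b : wedge_coords c (mxvec_index i (mxvec_index a b)) =
  c (i, (false, a)) * c (i, (true, b)) - c (i, (true, a)) * c (i, (false, b)).
Proof. by rewrite /wedge_coords mxvecE mxE mxvecE !mxE !big_ord1 !mxE. Qed.

Lemma wedge_coords_plucker (L : 'I_s -> line K) :
  wedge_coords (fun x => (if x.2.1 then (vbasis (sval (L x.1)))`_1 else (vbasis (sval (L x.1)))`_0) 0 x.2.2)
  = plucker_coords L.
Proof.
rewrite /wedge_coords /plucker_coords; apply: funext => k; congr (mxvec _ _ _).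
apply/matrixP => i j; rewrite !mxE; congr (mxvec _ _ _).
have rowK (u : 'rV[K]_4) : \row_a u 0 a = u by apply/rowP => a; rewrite mxE.
by rewrite /= !rowK.
Qed.

Lemma horner_mmap n (h : 'I_n -> {poly K}) (F : {mpoly K[n]}) t :
  (mmap polyC h F).[t] = F.@[fun i => (h i).[t]].
Proof.
rewrite /mmap mevalE horner_sum; apply: eq_bigr => m _.
rewrite hornerM hornerC /mmap1 horner_prod; congr (_ * _); apply: eq_bigr => i _.
by rewrite horner_exp.
Qed.

Lemma wedge_coords_poly (F : {mpoly K[s * (4 * 4)]}) c j :
  exists q : {poly K}, forall t, q.[t] = F.@[wedge_coords (update c j t)].
Proof.
have /choice[h hP] : forall k, exists q : {poly K}, forall t, q.[t] = wedge_coords (update c j t) k.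
  move=> k; case/mxvec_indexP: k => i ab; case/mxvec_indexP: ab => a b.
  pose x i := if i == j then 'X else (c i)%:P.
  have xE i' t : (x i').[t] = update c j t i'.
    by rewrite /x /update; case: eqP; rewrite !hornerE.
  exists (x (i, (false, a)) * x (i, (true, b)) - x (i, (true, a)) * x (i, (false, b))) => t.
  by rewrite wedge_coordsE !hornerE !xE.
by exists (mmap polyC h F) => t; rewrite horner_mmap; apply: meval_eq => k; apply: hP.
Qed.

Lemma wedge_plucker (u v : 'rV[K]_4) : exists (L : line K) l, wedge u v = l *: plucker L.
Proof.
have [fr|nfr] := boolP (free [:: u; v]); last first.
  (* A dependent pair has zero wedge: any line will do, with factor 0. *)
  exists (@affine_line K 0 0 0 0 isT), 0; rewrite scale0r.
  move: nfr; rewrite free_cons span_seq1 seq1_free negb_and !negbK.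
  case/orP=> [/vlineP[a ->]|/eqP ->]; last by rewrite /wedge trmx0 mulmx0 mul0mx subrr.
  by rewrite /wedge linearZ -scalemxAl -scalemxAr subrr.
have dimL : \dim <<[:: u; v]>>%VS == 2%N by apply: fr.
have [L LE] : exists L : line K, sval L = <<[:: u; v]>>%VS.
  by exists (exist (fun M : {vspace 'rV[K]_4} => \dim M == 2%N) _ dimL).
have span2 x : x \in <<[:: u; v]>>%VS -> exists a b,
    x = a *: (vbasis (sval L))`_0 + b *: (vbasis (sval L))`_1.
  rewrite -LE -[in X in X -> _](span_basis (plucker_basis L)) span_cons span_seq1.
  by case/memv_addP=> _ /vlineP[a ->] [_ /vlineP[b ->] ->]; exists a, b.
exists L; have [a [b ->]] := span2 u (memv_span (mem_head _ _)).
have [a' [b' ->]] : exists a b, v = a *: (vbasis (sval L))`_0 + b *: (vbasis (sval L))`_1.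
  by apply: span2; rewrite memv_span // !inE eqxx orbT.
exists (a * b' - b * a'); rewrite /wedge /plucker.
move: (_`_0) (_`_1) => x y; apply/matrixP => i j.
by rewrite !mxE !big_ord1 !mxE; ring.
Qed.

Lemma multihomogeneous_scale (F : {mpoly K[s * (4 * 4)]}) (x y : 'I_(s * (4 * 4)) -> K)
    (l : 'I_s -> K) : is_multihomogeneous F ->
  (forall i j, y (mxvec_index i j) = l i * x (mxvec_index i j)) ->
  exists a, F.@[y] = a * F.@[x].
Proof.
move=> /choice[d dP] yx; exists (\prod_i l i ^+ d i).
have prodE (z : 'I_(s * (4 * 4)) -> K) (m : 'X_{1..s * (4 * 4)}) : \prod_k z k ^+ m k =
    \prod_i \prod_j z (mxvec_index i j) ^+ m (mxvec_index i j).
  rewrite pair_bigA /= (reindex _ (curry_mxvec_bij s (4 * 4))) /=.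
  by apply: eq_bigr => -[i j].
rewrite !mevalE mulr_sumr; apply: eq_big_seq => m mF.
rewrite mulrCA !prodE; congr (_ * _); rewrite -big_split; apply: eq_bigr => i _ /=.
rewrite -(dP i m mF) -prodrXr -big_split; apply: eq_bigr => j _ /=.
by rewrite yx exprMn.
Qed.

(** Each [Z n] lies in the zero set of one multihomogeneous [F n] that is nonzero at some tuple. At
    a common nonzero point [c] of pairs of vectors, the value of [F n] is a multiple of its value at
    the Pluecker coordinates of suitable lines, so the latter is nonzero. *)
Lemma exists_general (Z : nat -> set ('I_s -> line K)) :
  (forall n, zariski_closed (Z n) /\ Z n != setT) -> exists L, forall n, ~ Z n L.
Proof.
move=> ZP.
have /choice[F FP] n : exists F : {mpoly K[s * (4 * 4)]}, [/\ is_multihomogeneous F,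
    forall L, F.@[plucker_coords L] != 0 -> ~ Z n L & exists L, F.@[plucker_coords L] != 0].
  have [[S [Shom ZE]] /eqP ZT] := ZP n.
  have [L0 nZ] : exists L0, ~ Z n L0.
    apply: contrapT => nL; apply: ZT; apply/seteqP; split => // L _.
    by apply: contrapT => nZ; apply: nL; exists L.
  have [F [SF FL0]] : exists F, S F /\ F.@[plucker_coords L0] != 0.
    apply: contrapT => nF; apply: nZ; rewrite ZE => F SF.
    by apply/eqP/negPn/negP => FL0; apply: nF; exists F.
  exists F; split; [exact: Shom | | by exists L0].
  by move=> L FL; rewrite ZE => /(_ F SF); apply/eqP.
have [c cP] : exists c, forall n, (F n).@[wedge_coords c] != 0.
  apply: (@avoid_zeros _ (fun n c => (F n).@[wedge_coords c])).
    by move=> n c j; apply: wedge_coords_poly.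
  by move=> n; have [_ _ [L FL]] := FP n; rewrite -wedge_coords_plucker in FL; eexists; apply: FL.
have /choice[L /choice[l Ll]] := fun i => wedge_plucker (\row_a c (i, (false, a))) (\row_a c (i, (true, a))).
exists L => n; have [Fhom FZ _] := FP n; apply: FZ.
have [a aE] : exists a, (F n).@[wedge_coords c] = a * (F n).@[plucker_coords L].
  apply: (multihomogeneous_scale (l := l)) => // i j.
  rewrite /wedge_coords /plucker_coords !mxvecE !mxE Ll.
  by rewrite linearZ mxE.
by apply: contraNneq (cP n) => FL; rewrite aE FL mulr0.
Qed.

End WedgeParametrization.
End Avoidance.

(** * The limit *)

(** Division of [m] by [N]: the remainder, less than [N], contributes at most the constant term. *)
Lemma subadditive_bound (a : nat -> nat) : (forall m n, a (m + n) <= a m + a n)%N ->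
  forall N m, (0 < N)%N -> (a m <= m %/ N * a N + (N * a 1 + a 0))%N.
Proof.
move=> suba N m N0; rewrite {1}(divn_eq m N).
have mul c r : (a (c * N + r) <= c * a N + a r)%N.
  by elim: c => [|c IHc] //; rewrite mulSn -addnA (leq_trans (suba _ _)) // mulSn -addnA leq_add2l.
have lin r : (a r <= r * a 1 + a 0)%N.
  elim: r => [|r IHr] //; rewrite -addn1 (leq_trans (suba _ _)) // mulnDl mul1n; lia.
apply: leq_trans (mul _ _) _; rewrite leq_add2l (leq_trans (lin _)) // leq_add2r leq_mul2r.
by rewrite ltnW ?orbT // ltn_mod.
Qed.

(** The limit is the infimum of the quotients. *)
Lemma fekete (R : realType) (a : nat -> nat) : (forall m n, a (m + n) <= a m + a n)%N ->
  exists w : R, (fun m => (a m)%:R / m%:R : R) @ \oo --> w.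
Proof.
move=> suba; pose E : set R := [set x | exists2 m, (0 < m)%N & x = (a m)%:R / m%:R].
have lbE : has_lbound E by exists 0 => _ [m _ ->]; rewrite divr_ge0.
have infE : has_inf E by split=> //; exists ((a 1)%:R / 1%:R); exists 1%N.
exists (inf E); apply/cvgrPdist_le => eps eps0.
(* The quotient at [N] is within eps / 2 of the infimum; the constant [B] takes up the other eps / 2
   for large [m]. *)
have [_ [N N0 ->] ltN] := inf_adherent (divr_gt0 eps0 (ltr0n R 2)) infE.
have [B BE] : exists B : R, B = (N * a 1 + a 0)%:R by eexists.
near=> m.
have m0 : (0 < m)%N by near: m; exists 1%N.
have lem : inf E <= (a m)%:R / m%:R by apply: ge_inf => //; exists m.
have leB : B <= eps / 2 * m%:R.
  by rewrite mulrC -ler_pdivrMr ?divr_gt0 // ltW //; near: m; apply: nbhs_infty_gtr.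
rewrite ler0_norm ?subr_le0 // opprB lerBlDl ler_pdivrMr ?ltr0n //.
have := subadditive_bound suba m N0; rewrite -(ler_nat R) natrD natrM -BE => /le_trans; apply.
have -> : (a N)%:R = N%:R * ((a N)%:R / N%:R) :> R by rewrite mulrCA divff ?mulr1 // pnatr_eq0 -lt0n.
rewrite [(m %/ N)%:R * _]mulrA -natrM.
have leN : (m %/ N * N)%:R * ((a N)%:R / N%:R) <= m%:R * ((a N)%:R / N%:R) :> R.
  by rewrite ler_wpM2r ?divr_ge0 // ler_nat leq_divM.
have ltm : m%:R * ((a N)%:R / N%:R) <= m%:R * (inf E + eps / 2) by rewrite ler_wpM2l // ltW.
by apply: le_trans (lerD (le_trans leN ltm) leB) _; lra.
Unshelve. all: by end_near. Qed.

(** * Initial degrees for lines outside the exceptional loci *)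

Section GeneralLines.
Variables (K : fieldType) (charK : [pchar K] =i pred0) (s : nat).
Implicit Types (L : 'I_s -> line K).

Lemma nonzero_in_degreeP L t m :
  nonzero_in_degree (symbolic_power (lines_ideal L) m) t <-> vanishing_locus t m L.
Proof.
split=> [[f [/(symbolic_powerP charK) vf hf f0]] | [f [hf f0 vf]]]; exists f; split => //.
exact/(symbolic_powerP charK).
Qed.

(** The form is the m-th power of a product of linear forms, one vanishing on each line. Hence
    [initial_degree] is a true minimum and not its default value. *)
Lemma ex_nonzero_in_degree L m :
  exists t, nonzero_in_degree (symbolic_power (lines_ideal L) m) t.
Proof.
have /choice[u uP] i : exists u : {mpoly K[4]},
    [/\ vanishing_ideal (sval (L i)) u, u \is 1.-homog & u != 0].
  have /subvPn[x _ nLx] : ~~ (fullv <= sval (L i))%VS.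
    apply/negP => /dimvS; rewrite (eqP (svalP (L i))) dimvf /dim /= mul1n.
    by [].
  have [u [Lu hu ux]] := form_separates nLx.
  by exists u; split=> //; apply: contraNneq ux => ->; rewrite meval0.
exists (\sum_(i < s) 1 * m)%N; apply/nonzero_in_degreeP.
exists (\prod_i u i ^+ m); split.
- elim/big_rec2: _ => [|i x d _ hx]; first exact: dhomog1.
  by apply: dhomogM => //; apply: dhomogMn; case: (uP i).
- by apply/prodf_neq0 => i _; apply: expf_neq0; case: (uP i).
move=> i; apply: vanishes_along_power; rewrite (bigD1 i) //= mulrC.
apply: ideal_powerMl; rewrite -[u i ^+ m]mulr1 -[X in ideal_power _ X]addn0.
by apply: ideal_powerX; [case: (uP i) | apply: ideal_power0].
Qed.

Lemma initial_degreeP L m (alpha := initial_degree (symbolic_power (lines_ideal L) m)) :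
  vanishing_locus alpha m L /\ forall t, vanishing_locus t m L -> (alpha <= t)%N.
Proof.
pose P t := `[< nonzero_in_degree (symbolic_power (lines_ideal L) m) t >].
have exP : exists t, P t by have [t] := ex_nonzero_in_degree L m; exists t; apply/asboolP.
have [d /asboolP Pd dmin] := ex_minnP exP.
have [] := @xgetPex _ 0%N [set t | nonzero_in_degree (symbolic_power (lines_ideal L) m) t /\
  forall t', nonzero_in_degree (symbolic_power (lines_ideal L) m) t' -> (t <= t')%N].
  by exists d; split=> // t' Pt'; apply: dmin; apply/asboolP.
rewrite -/(initial_degree _) -/alpha => /nonzero_in_degreeP Pa amin.
by split=> // t vt; apply: amin; apply/nonzero_in_degreeP.
Qed.

Lemma initial_degreeD L m n : (initial_degree (symbolic_power (lines_ideal L) (m + n)) <=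
  initial_degree (symbolic_power (lines_ideal L) m) + initial_degree (symbolic_power (lines_ideal L) n))%N.
Proof.
apply: (initial_degreeP L (m + n)).2.
have [[f [hf f0 vf]] _] := initial_degreeP L m.
have [[g [hg g0 vg]] _] := initial_degreeP L n.
exists (f * g); split; [exact: dhomogM | exact: mulf_neq0 |].
move=> i p v Lp; rewrite exprD rmorphM.
by apply: dvdp_mul; [exact: (vf i p v Lp) | exact: (vg i p v Lp)].
Qed.

Lemma waldschmidt_exists (R : realType) L : exists w : R, is_waldschmidt (lines_ideal L) w.
Proof. exact: fekete (initial_degreeD L). Qed.

Lemma zariski_closed_set0 : zariski_closed (set0 : set ('I_s -> line K)).
Proof.
exists [set 1]; split=> [_ -> i|].
  by exists 0%N => mn; rewrite msupp1 inE => /eqP ->; rewrite big1 // => j _; rewrite mnm0E.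
apply/esym/seteqP; split=> // L /(_ 1 erefl); rewrite meval1 => /eqP.
by rewrite oner_eq0.
Qed.

(** The pairs (t, m) are enumerated by [unpickle]. Loci equal to the whole space become empty, as
    [very_general] asks for proper closed sets. *)
Definition special_locus (n : nat) : set ('I_s -> line K) :=
  if unpickle n is Some (t, m) then
    if vanishing_locus t m == setT :> set ('I_s -> line K) then set0 else vanishing_locus t m
  else set0.

Definition general L := forall n, ~ special_locus n L.

Lemma special_locus_closed n : zariski_closed (special_locus n) /\ special_locus n != setT.
Proof.
have s0 : zariski_closed (set0 : set ('I_s -> line K)) /\ (set0 : set ('I_s -> line K)) != setT.
  split; first exact: zariski_closed_set0.
  apply/eqP => /seteqP[_ /(_ (fun=> @affine_line K 0 0 0 0 isT))]; exact.
rewrite /special_locus; case: unpickle => [[t m]|] //.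
by have [//|ne] := eqVneq (vanishing_locus t m) setT; split=> //; apply: vanishing_locus_closed.
Qed.

Lemma very_general_general (P : ('I_s -> line K) -> Prop) :
  (forall L, general L -> P L) -> very_general P.
Proof.
move=> gP; exists special_locus; split; first exact: special_locus_closed.
by move=> L nL; apply: gP => n Zn; apply: nL; exists n.
Qed.

Lemma general_locus L t m : general L -> vanishing_locus t m L ->
  vanishing_locus t m = setT :> set ('I_s -> line K).
Proof.
move=> gL vL; apply/eqP/negPn/negP => ne.
by apply: (gL (pickle (t, m))); rewrite /special_locus pickleK (negPf ne).
Qed.

(** A degree attained at a general tuple is attained at every tuple; exchanging the two tuples gives
    equality. *)
Lemma general_initial_degree L L' m : general L -> general L' ->
  initial_degree (symbolic_power (lines_ideal L) m) =
  initial_degree (symbolic_power (lines_ideal L') m).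
Proof.
have le (M M' : 'I_s -> line K) : general M -> (initial_degree (symbolic_power (lines_ideal M') m) <=
    initial_degree (symbolic_power (lines_ideal M) m))%N.
  move=> gM; apply: (initial_degreeP M' m).2.
  by rewrite (general_locus gM (initial_degreeP M m).1).
by move=> gL gL'; apply/eqP; rewrite eqn_leq !le.
Qed.

(** The initial degree at [L] is attained by a form for the special lines too, where successive
    division bounds it. *)
Lemma general_initial_degree_ge k a L m : (k * k + a * a <= s)%N -> general L ->
  ((k + a) * m <= initial_degree (symbolic_power (lines_ideal L) m))%N.
Proof.
move=> les gL; have vT := general_locus gL (initial_degreeP L m).1.
have : vanishing_locus (initial_degree (symbolic_power (lines_ideal L) m)) m
   (fun i : 'I_s => special_line K k a i) by rewrite vT.
case=> f [hf f0 vf]; apply: (special_line_degree charK les hf f0) => i.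
exact/(vanishes_along_ideal_power charK)/vf.
Qed.

End GeneralLines.

(** The two sequences of exceptional sets are interleaved by parity into one. *)
Lemma very_general_exists (K : fieldType) s (P Q : ('I_s -> line K) -> Prop) :
  ~ countable [set: K] -> very_general P -> very_general Q -> exists L, P L /\ Q L.
Proof.
move=> uncK [Z [Zc ZP]] [Z' [Z'c Z'Q]].
have [|L nL] := exists_general uncK (Z := fun n => if odd n then Z n./2 else Z' n./2).
  by move=> n; case: odd.
exists L; split.
  by apply: ZP => -[n _ Zn]; apply: (nL n.*2.+1); rewrite /= odd_double /= uphalf_double.
by apply: Z'Q => -[n _ Zn]; apply: (nL n.*2); rewrite odd_double doubleK.
Qed.

Lemma square_split (s q k : nat) : (q%:Z - k%:Z) ^+ 2 <= s%:Z - k%:Z ^+ 2 ->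
  exists b a : nat, (b + a)%N = q /\ (b * b + a * a <= s)%N.
Proof.
move=> h; have [le|lt] := leqP k q.
  by exists k, (q - k)%N; split; [lia | nia].
(* For q < k the second family is empty, and $q^2 < k^2 \le s$. *)
by exists q, 0%N; split; [lia | nia].
Qed.

Theorem theorem1 (R : realType) (K : closedFieldType)
    (charK : [pchar K] =i pred0) (uncountableK : ~ countable [set: K])
    (s q k : nat) (s_gt0 : (0 < s)%N) (q_gt0 : (0 < q)%N) (k_gt0 : (0 < k)%N)
    (hsqk : (q%:Z - k%:Z) ^+ 2 <= s%:Z - k%:Z ^+ 2) :
  q%:R <= waldschmidt_lines R K s.
Proof.
have [b [a [ba les]]] := square_split hsqk.
have gen : very_general (fun L => @general K s L) by apply: very_general_general.
have [L0 [gL0 _]] := very_general_exists uncountableK gen gen.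
have [w wP] := waldschmidt_exists charK R L0.
have : very_general (fun L : 'I_s -> line K => is_waldschmidt (lines_ideal L) (waldschmidt_lines R K s)).
  (* A valid constant exists, so [xget] does not return its default 0: all general tuples have the
     initial degrees of [L0], hence its limit [w]. *)
  apply: (@xgetPex _ 0 [set w | @very_general K s (fun L => is_waldschmidt (lines_ideal L) w)]).
  exists w; apply: very_general_general => L gL.
  rewrite /is_waldschmidt (_ : (fun m => _) = (fun m : nat =>
    (initial_degree (symbolic_power (lines_ideal L0) m))%:R / m%:R)) //.
  by apply: funext => m; rewrite (general_initial_degree charK m gL gL0).
case/(very_general_exists uncountableK gen) => L [gL wL].
apply: (cvgr_to_ge wL); near=> m.
have m0 : (0 < m)%N by near: m; exists 1%N.
rewrite ler_pdivlMr ?ltr0n // -natrM ler_nat -ba.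
exact: general_initial_degree_ge.
Unshelve. all: by end_near. Qed.
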